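(* Let $(X,\mathcal{X},\mu,(T^{t})_{t\in\mathbb{R}})$ and $(X,\mathcal{X},\mu,(S^{t})_{t\in\mathbb{R}})$ be two measurable flows on the same Lebesgue probability space, and let $c\in\mathbb{R}$. For any $k\in\mathbb{N}$, any $P\in\mathbb{Z}[t_1,\ldots,t_k]$ with $\deg P=1$, and any $f,g\in L^{\infty}(\mu)$, the limit $$L(f,g)(x):=\lim_{\min\{M_1,\ldots,M_k\}\to\infty}\frac{1}{M_{1}\cdots M_{k}}\int_{\prod_{j=1}^{k}[0,M_j]}f(T^{|\mathbf{t}|}x)\,g(S^{|\mathbf{t}|^{2}+cP(\mathbf{t})}x)\,d\mathbf{t}$$ exists for $\mu$-a.e. $x\in X$, where $|\mathbf{t}|=|t_1|+\cdots+|t_k|$ for $\mathbf{t}=(t_1,\ldots,t_k)$. Moreover, for $\mu$-a.e. $x\in X$, $$L(f,g)(x)=\mathbb{E}_{\mu}\big(f\,|\,\mathcal{I}((T^t)_{t\in\mathbb{R}})\big)(x)\;\mathbb{E}_{\mu}\big(g\,|\,\mathcal{I}((S^t)_{t\in\mathbb{R}})\big)(x).$$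
   Context: For $D\in\mathbb{N}=\{1,2,\dots\}$, a measurable flow $(X,\mathcal{X},\mu,(T^{\mathbf{t}})_{\mathbf{t}\in\mathbb{R}^D})$ consists of a Lebesgue probability space $(X,\mathcal{X},\mu)$ and a $D$-parameter group $(T^{\mathbf{t}})_{\mathbf{t}\in\mathbb{R}^D}$ of invertible measure preserving transformations of $X$ such that the map $\mathbb{R}^D\times X\to X$, $(\mathbf{t},x)\mapsto T^{\mathbf{t}}x$, is measurable. Here $D=1$. No commutation between the two actions $(T^t)$ and $(S^t)$ is assumed. $\mathcal{I}((T^{t})_{t\in\mathbb{R}})$ is the sub-$\sigma$-algebra of $\mathcal{X}$ generated by $\{A\in\mathcal{X}: T^{t}A=A\ (\mathrm{mod}\ \mu)\text{ for each }t\in\mathbb{R}\}$ (similarly for $S$), and $\mathbb{E}_\mu(f|\mathcal{F})$ is the conditional expectation of $f$ with respect to the sub-$\sigma$-algebra $\mathcal{F}$. The $M_j$ range over positive reals, and the limit is taken as $\min\{M_1,\ldots,M_k\}\to\infty$ with no other relation among the $M_j$. *)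

(* Defs.v *)
(* MathComp / MathComp-Analysis. mpoly is imported without its notations, which
   clash with those of MathComp-Analysis, and before it, as both declare names
   such as isMeasure. *)
From HB Require Import structures.
From mathcomp Require Import all_boot all_order all_algebra.
From mathcomp Require Import -(notations) mpoly.
From mathcomp Require Import all_classical all_reals all_analysis measurable_realfun.
Set Implicit Arguments.
Unset Strict Implicit.
Unset Printing Implicit Defensive.
Import Order.TTheory GRing.Theory Num.Theory.
Import numFieldNormedType.Exports.
Local Open Scope classical_set_scope.
Local Open Scope ring_scope.

Section lebesgue_space.
Context (R : realType).

(* Lebesgue measure on the interval [0, a] plus an atom of mass p n at the
   point -(n+1) for each n (no atom when p n = 0). *)
Definition interval_atoms (a : R) (p : nat -> R) (B : set R) : \bar R :=
  (lebesgue_measure (B `&` `[0%R, a]%classic) +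
   \sum_(0 <= n <oo) (p n)%:E * \d_((- n.+1%:R)%R : R) B)%E.

(* mu is isomorphic mod 0 to an interval with at most countably many atoms.
   The sigma-algebra of X need not be complete: images of measurable sets are
   only required to be measurable for the completion of the model, so that a
   standard Borel probability space and its completion both qualify. That
   a + \sum_n p n = 1 follows from the penultimate clause. *)
Definition lebesgue_space d (X : measurableType d) (mu : probability X R) :=
  exists (a : R) (p : nat -> R) (X0 : set X) (phi : X -> R),
    [/\ 0 <= a /\ (forall n, 0 <= p n),
        [/\ measurable X0, mu X0 = 1%E & {in X0 &, injective phi}],
        measurable_fun X0 phi,
        forall B : set R, measurable B ->
          mu (X0 `&` phi @^-1` B) = interval_atoms a p B &
        (interval_atoms a p).-negligible (~` (phi @` X0)) /\
        forall A : set X, measurable A ->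
          completed_algebra_gen (interval_atoms a p) (phi @` (A `&` X0))].

End lebesgue_space.

Section flows.
Context (R : realType) d (X : measurableType d) (mu : probability X R).

Definition measure_preserving (f : X -> X) :=
  measurable_fun [set: X] f /\
  forall A : set X, measurable A -> mu (f @^-1` A) = mu A.

(* Invertibility of T t, with measurable inverse T (- t), follows from the
   group law. *)
Definition measurable_flow (T : R -> X -> X) :=
  [/\ T 0 = id,
      forall s t, T (s + t) = T s \o T t,
      forall t, measure_preserving (T t) &
      measurable_fun [set: R * X] (fun p => T p.1 p.2)].

Definition invariant_sets (T : R -> X -> X) : set (set X) :=
  [set A | measurable A /\
           forall t, mu.-negligible ((T t @` A) `+` A)].

Definition invariant_sigma_algebra (T : R -> X -> X) : set (set X) :=
  <<s invariant_sets T >>.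

Definition is_cond_exp (F : set (set X)) (f h : X -> R) :=
  [/\ forall B : set R, measurable B -> F (h @^-1` B),
      mu.-integrable [set: X] (EFin \o h) &
      forall A, F A ->
        (\int[mu]_(x in A) (h x)%:E = \int[mu]_(x in A) (f x)%:E)%E].

(* A version of E(f | F), for F a sub-sigma-algebra and f integrable; any two
   versions agree mu-almost everywhere. *)
Definition cond_exp (F : set (set X)) (f : X -> R) : X -> R :=
  xget (cst 0) [set h | is_cond_exp F f h].

End flows.

Section lebesgue_tuple.
Context (R : realType).

Definition cons_pair k (p : R * k.-tuple R) : k.+1.-tuple R :=
  [tuple of p.1 :: p.2].

Lemma measurable_cons_pair k : measurable_fun setT (@cons_pair k).
Proof. exact: measurable_cons. Qed.

Section cons.
Context k (m : {sigma_finite_measure set (k.-tuple R) -> \bar R}).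

Definition lebesgue_cons : set (k.+1.-tuple R) -> \bar R :=
  pushforward (@lebesgue_measure R \x m)%E (@cons_pair k).

Let lebesgue_cons0 : lebesgue_cons set0 = 0%E.
Proof. by rewrite /lebesgue_cons /pushforward preimage_set0 measure0. Qed.

Let lebesgue_cons_ge0 A : (0 <= lebesgue_cons A)%E.
Proof. exact: (measure_ge0 (@lebesgue_measure R \x m)%E). Qed.

Let lebesgue_cons_sigma_additive : semi_sigma_additive lebesgue_cons.
Proof.
move=> F mF tF mUF; rewrite /lebesgue_cons /pushforward preimage_bigcup.
have mp A : measurable A -> measurable (@cons_pair k @^-1` A).
  by move=> mA; rewrite -[X in measurable X]setTI; exact: measurable_cons_pair.
apply: measure_semi_sigma_additive.
- by move=> n; exact: mp.
- apply/trivIsetP => /= i j _ _ ij; rewrite -preimage_setI.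
  by move/trivIsetP : tF => /(_ _ _ _ _ ij) ->//; rewrite preimage_set0.
- by rewrite -preimage_bigcup; exact: mp.
Qed.

HB.instance Definition _ := isMeasure.Build _ _ _ lebesgue_cons
  lebesgue_cons0 lebesgue_cons_ge0 lebesgue_cons_sigma_additive.

Let lebesgue_cons_sigma_finite : sigma_finite setT lebesgue_cons.
Proof.
have /sigma_finiteP[F [TF ndF Foo]] := sigma_finiteT (@lebesgue_measure R).
have /sigma_finiteP[G [TG ndG Goo]] := sigma_finiteT m.
pose ux (t : k.+1.-tuple R) : measurableTypeR R * k.-tuple R :=
  (thead t, [tuple of behead t]).
have mux : measurable_fun setT ux.
  apply/measurable_fun_pair; first exact: measurable_tnth.
  exact: measurable_behead.
have uxK : cancel (@cons_pair k) ux.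
  by move=> [x t]; congr pair; apply: val_inj.
exists (fun n => ux @^-1` (F n `*` G n)).
  apply/esym/seteqP; split=> // t _.
  have [n _ Fn] : (\bigcup_n F n) (thead t) by rewrite -TF.
  have [p _ Gp] : (\bigcup_n G n) [tuple of behead t] by rewrite -TG.
  exists (maxn n p) => //; split.
  - by move: Fn; exact/subsetPset/ndF/leq_maxl.
  - by move: Gp; exact/subsetPset/ndG/leq_maxr.
move=> n; have [mF Fn] := Foo n; have [mG Gn] := Goo n; split.
  by rewrite -[X in measurable X]setTI; apply: mux => //; exact: measurableX.
rewrite /lebesgue_cons /pushforward -comp_preimage.
rewrite (_ : ux \o _ = id); last by apply/funext => p /=; rewrite uxK.
by rewrite preimage_id product_measure1E// lte_mul_pinfty// ge0_fin_numE.
Qed.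

HB.instance Definition _ := Measure_isSigmaFinite.Build _ _ _ lebesgue_cons
  lebesgue_cons_sigma_finite.

End cons.

(* k-dimensional Lebesgue measure, as the k-fold product of lebesgue_measure. *)
Fixpoint lebesgue_tuple k : {sigma_finite_measure set (k.-tuple R) -> \bar R} :=
  match k with
  | 0 => \d_[tuple]
  | k'.+1 => lebesgue_cons (lebesgue_tuple k')
  end.

Definition box k (M : k.-tuple R) : set (k.-tuple R) :=
  [set t | forall j, 0 <= tnth t j <= tnth M j].

Lemma measurable_box k (M : k.-tuple R) : measurable (box M).
Proof.
rewrite (_ : box M = \bigcap_(j in [set: 'I_k])
    (fun t : k.-tuple R => tnth t j) @^-1` `[0, tnth M j]%classic).
  apply: fin_bigcap_measurable => // j _; rewrite -[X in measurable X]setTI.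
  exact: measurable_tnth.
by apply/seteqP; split => [t tM j _|t tM j] /=;
  [rewrite in_itv; exact: tM|have := tM j I; rewrite /= in_itv].
Qed.

Lemma lebesgue_tuple_box k (M : k.-tuple R) : (forall j, 0 <= tnth M j) ->
  lebesgue_tuple k (box M) = (\prod_(j < k) tnth M j)%:E.
Proof.
elim: k M => [|k IH] M M0.
  rewrite big_ord0 /= diracE mem_set//.
  by case.
pose M' : k.-tuple R := [tuple of behead M].
have tM j : tnth M' j = tnth M (lift ord0 j).
  by rewrite [in RHS](tuple_eta M) tnthS.
rewrite /= /lebesgue_cons /pushforward.
rewrite (_ : _ @^-1` _ = `[0, tnth M ord0]%classic `*` box M'); last first.
  apply/seteqP; split => -[x t] /=.
    move=> tbox; split => [|j]; first by have := tbox ord0; rewrite tnth0 in_itv.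
    by have := tbox (lift ord0 j); rewrite tnthS tM.
  rewrite in_itv/= => -[x0 tbox] j; case: (unliftP ord0 j) => [i ->|->].
    by rewrite tnthS -tM.
  by rewrite tnth0.
transitivity (@lebesgue_measure R `[0%R, tnth M ord0]%classic *
    lebesgue_tuple k (box M'))%E.
  by apply: product_measure1E => //; exact: measurable_box.
rewrite IH => [|j]; last by rewrite tM.
rewrite big_ord_recl lebesgue_measure_itv/= lte_fin.
have [|] := ltP 0 (tnth M ord0); last first.
  move=> M00; rewrite (@le_anti _ _ (tnth M ord0) 0) ?M00 ?M0//.
  by rewrite mul0e mul0r.
move=> _; rewrite oppr0 adde0 EFinM.
by congr (_ * _)%E; congr EFin; apply: eq_bigr => j _; rewrite tM.
Qed.

Definition norm1 k (t : k.-tuple R) : R := \sum_(j < k) `|tnth t j|.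

(* Neighbourhoods of infinity for the limit min_j M_j --> +oo. *)
Definition min_pinfty (k : nat) : set_system (k.-tuple R) :=
  filter_from [set: R] (fun A => [set M | forall j, A < tnth M j]).

Global Instance min_pinfty_filter k : ProperFilter (@min_pinfty k).
Proof.
apply: filter_from_proper; last first.
  move=> A _; exists [tuple of nseq k (A + 1)] => j.
  by rewrite tnth_nseq ltrDl.
apply: filter_from_filter; first by exists 0.
move=> A B _ _; exists (Num.max A B) => // M MAB.
by split=> j; have := MAB j; rewrite gt_max => /andP[].
Qed.

(* msize P is one more than the total degree of P, and msize 0 = 0. *)
Definition mpoly_degree k (P : mpoly k int) : nat := (msize P).-1.

Definition mpoly_eval k (P : mpoly k int) (t : k.-tuple R) : R :=
  mmap intr (tnth t) P.

End lebesgue_tuple.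
Arguments min_pinfty : clear implicits.

Definition box_average (R : realType) d (X : measurableType d)
    (T S : R -> X -> X) (c : R) k (P : mpoly k int) (f g : X -> R) (x : X)
    (M : k.-tuple R) : R :=
  (\prod_(j < k) tnth M j)^-1 *
  \int[lebesgue_tuple R k]_(t in box M)
    (f (T (norm1 t) x) * g (S (norm1 t ^+ 2 + c * mpoly_eval P t) x)).

(* Main.v *)
Require Import Defs.
From mathcomp Require Import all_boot all_order all_algebra.
From mathcomp Require Import -(notations) mpoly.
From mathcomp Require Import all_classical all_reals all_analysis.
From mathcomp Require Import measurable_realfun ess_sup_inf ring lra.
Import Order.TTheory GRing.Theory Num.Theory.
Import numFieldNormedType.Exports.
Local Open Scope classical_set_scope.
Local Open Scope ring_scope.

Set Implicit Arguments.
Unset Strict Implicit.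
Unset Printing Implicit Defensive.

(** Fix a point x and write F t = f (T^t x), G u = g (S^u x). The average under
    study is that of F (|t|) G (|t|^2 + c P(t)) over a box, a product of two
    functions on the line. The idea is that the argument of G moves at speed of
    order |t|, so that G has averaged out to its mean before F changes.

    Ergodic theorem. The maximal ergodic theorem ([maximal_ergodic]) for the time
    one map yields the convergence of the averages of a bounded function along
    almost every orbit ([birkhoff]). The upper limit of the averages over [0, n],
    [orbit_mean], is exactly invariant, and it is a version of the conditional
    expectation given the invariant sets ([cond_exp_orbit_mean]). It follows that
    a sequence of nonnegative functions whose integrals tend to 0 has, at almost
    every point, orbit means as small as desired ([small_mean]). This is used
    twice. For f, the local averages (1/h) int_0^h f(T^s x) ds tend to f in mean as
    h tends to 0, and they are Lipschitz along orbits; so along almost every orbit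
    F can be replaced by a Lipschitz function ([ae_lipschitz_approximable]). For g,
    the ergodic averages of length L tend in mean to the conditional expectation
    of g; so after subtraction of this constant the averages of G over windows of
    length L are small for most positions of the window
    ([ae_small_window_means]).

    Estimate on a line. Suppose that F is Lipschitz and that G has small window
    means, and restrict the integral to a segment of length M parallel to an axis.
    Up to a translation the phase is z^2 + q with z in [a, b], where a and b are of
    order M after a short initial piece is dropped. The substitution u = z^2,
    which has to be justified for a measurable function G ([Rintegral_square]),
    gives an integral of W u G (u + q), where W varies by O(L / M^2) over a window
    of length L. Hence G can be replaced by its window means
    ([quadratic_phase_bound]), and the result is at most of order 1 / M times an
    integral of these means over an interval of length of order M^2: a small
    multiple of M ([quadratic_fiber_small]).

    Boxes. These bounds are uniform in the other coordinates as long as those are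
    O(M). Therefore the segment is chosen parallel to the longest side of the box,
    and Fubini's theorem in this coordinate concludes ([box_fiber_bound]). Applied
    to F alone, the same choice shows that the averages of F (|t|) converge to the
    mean of F ([box_mean_norm1]), and [box_mean_product] puts the pieces
    together. *)

(** * Bounded measurable functions *)

(** The bound holds everywhere, not only almost everywhere, so that it passes to
    the restriction of f to each single orbit of a flow. *)
Definition bounded_by d (T : measurableType d) (R : realType) (C : R)
  (f : T -> R) := measurable_fun [set: T] f /\ forall x, `|f x| <= C.

Section bounded_measurable.
Context d (T : measurableType d) (R : realType).
Implicit Types (f g : T -> R) (C : R) (D : set T).

Lemma bounded_by_ge0 C f (x : T) : bounded_by C f -> 0 <= C.
Proof. by move=> [_ /(_ x)]; exact: le_trans. Qed.

Lemma bounded_by_cst (c : R) : bounded_by `|c| (fun _ : T => c).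
Proof. by split. Qed.

Lemma bounded_byN C f : bounded_by C f -> bounded_by C (fun x => - f x).
Proof.
by move=> [mf fC]; split=> [|x]; [exact: measurableT_comp|rewrite normrN].
Qed.

Lemma bounded_byD C C' f g : bounded_by C f -> bounded_by C' g ->
  bounded_by (C + C') (fun x => f x + g x).
Proof.
move=> [mf fC] [mg gC]; split=> [|x]; first exact: measurable_funD.
by rewrite (le_trans (ler_normD _ _))// lerD.
Qed.

Lemma bounded_byB C C' f g : bounded_by C f -> bounded_by C' g ->
  bounded_by (C + C') (fun x => f x - g x).
Proof. by move=> bf bg; exact/bounded_byD/bounded_byN. Qed.

Lemma bounded_byM C C' f g : bounded_by C f -> bounded_by C' g ->
  bounded_by (C * C') (fun x => f x * g x).
Proof.
move=> [mf fC] [mg gC]; split=> [|x]; first exact: measurable_funM.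
by rewrite normrM ler_pM.
Qed.

Lemma bounded_by_norm C f : bounded_by C f -> bounded_by C (fun x => `|f x|).
Proof.
move=> [mf fC]; split=> [|x]; last by rewrite normr_id.
exact: measurableT_comp.
Qed.

Lemma bounded_by_comp d' (T' : measurableType d') (u : T' -> T) C f :
  measurable_fun [set: T'] u -> bounded_by C f ->
  bounded_by C (fun x => f (u x)).
Proof. by move=> mu [mf fC]; split=> // ; exact: measurableT_comp. Qed.

Context (mu : {measure set T -> \bar R}).

Lemma bounded_by_integrable C f D : measurable D -> (mu D < +oo)%E ->
  bounded_by C f -> mu.-integrable D (EFin \o f).
Proof.
move=> mD Doo [mf fC]; apply: measurable_bounded_integrable => //.
  exact: measurable_funTS.
exists C; split; first exact: num_real.
by move=> y Cy x _; exact: le_trans (fC x) (ltW Cy).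
Qed.

Lemma le_norm_Rintegral_in C K f D : measurable D -> (mu D < +oo)%E ->
  bounded_by C f -> (forall x, D x -> `|f x| <= K) ->
  `|\int[mu]_(x in D) f x| <= K * fine (mu D).
Proof.
move=> mD Doo bf fK.
apply: (le_trans (le_normr_Rintegral mD (bounded_by_integrable mD Doo bf))).
rewrite -Rintegral_cst//; apply: le_Rintegral => //.
  exact: bounded_by_integrable (bounded_by_norm bf).
exact: bounded_by_integrable (bounded_by_cst K).
Qed.

Lemma le_norm_Rintegral C f D : measurable D -> (mu D < +oo)%E ->
  bounded_by C f -> `|\int[mu]_(x in D) f x| <= C * fine (mu D).
Proof.
by move=> mD Doo bf; apply: (le_norm_Rintegral_in mD Doo bf) => x _; exact: bf.2.
Qed.

End bounded_measurable.

Section fubini_bounded.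
Context d1 d2 (T1 : measurableType d1) (T2 : measurableType d2) (R : realType).
Context (m1 : {sigma_finite_measure set T1 -> \bar R}).
Context (m2 : {sigma_finite_measure set T2 -> \bar R}).
Context (D1 : set T1) (D2 : set T2).
Context (mD1 : measurable D1) (mD2 : measurable D2).
Context (D1oo : (m1 D1 < +oo)%E) (D2oo : (m2 D2 < +oo)%E).

Lemma bounded_by_pair1 C (f : T1 -> T2 -> R) x :
  bounded_by C (fun z => f z.1 z.2) -> bounded_by C (f x).
Proof.
move=> bf; rewrite (_ : f x = fun y => (fun z => f z.1 z.2) (x, y))//.
by apply: bounded_by_comp bf; exact: measurable_pair1.
Qed.

Lemma bounded_by_pair2 C (f : T1 -> T2 -> R) y :
  bounded_by C (fun z => f z.1 z.2) -> bounded_by C (f ^~ y).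
Proof.
move=> bf; rewrite (_ : f ^~ y = fun x => (fun z => f z.1 z.2) (x, y))//.
by apply: bounded_by_comp bf; exact: measurable_pair2.
Qed.

(** Adding the constant C makes the integrand nonnegative, and then the
    measurability in x is part of Tonelli's theorem. *)
Lemma bounded_by_Rintegral C (f : T1 -> T2 -> R) :
  bounded_by C (fun z => f z.1 z.2) ->
  bounded_by (C * fine (m2 D2)) (fun x => \int[m2]_(y in D2) f x y).
Proof.
move=> bf; have [mf fC] := bf.
have bfx x := bounded_by_pair1 x bf.
split=> [|x]; last exact: le_norm_Rintegral.
pose h (z : T1 * T2) : \bar R := ((f z.1 z.2 + C) * \1_D2 z.2)%:E.
have mh : measurable_fun setT h.
  apply/measurable_EFinP; apply: measurable_funM.
    by apply: measurable_funD => //; exact: measurable_cst.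
  by apply: measurableT_comp => //; exact: measurable_indic.
have h0 z : (0 <= h z)%E.
  rewrite lee_fin mulr_ge0// ?indicE//.
  by have := fC z; rewrite ler_norml lerNl -subr_ge0 opprK addrC => /andP[].
have -> : (fun x => \int[m2]_(y in D2) f x y) =
    (fun x => fine (fubini_F m2 h x) - C * fine (m2 D2)).
  apply/funext => x; rewrite -Rintegral_cst// /fubini_F.
  transitivity (\int[m2]_(y in D2) (f x y + C) - \int[m2]_(y in D2) C).
    rewrite RintegralD// ?addrK//; first exact: bounded_by_integrable (bfx x).
    exact: bounded_by_integrable (bounded_by_cst _ C).
  congr (_ - _); rewrite Rintegral_mkcond; congr fine.
  apply: eq_integral => y _; rewrite /h/= patchE indicE.
  by case: ifP; rewrite ?mulr1 ?mulr0.
apply: measurable_funB; last exact: measurable_cst.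
apply: measurableT_comp => //.
exact: measurable_fun_fubini_tonelli_F.
Qed.

Let cut C (f : T1 -> T2 -> R) : bounded_by C (fun z => f z.1 z.2) ->
  (m1 \x m2)%E.-integrable setT
    (EFin \o ((fun z : T1 * T2 => f z.1 z.2) \_ (D1 `*` D2))).
Proof.
move=> bf; rewrite -restrict_EFin; apply/integrable_restrict => //.
  exact: measurableX.
rewrite setTI; apply: bounded_by_integrable bf; first exact: measurableX.
rewrite [X in (X < _)%E](_ : _ = (m1 D1 * m2 D2)%E); last first.
  exact: product_measure1E.
by rewrite lte_mul_pinfty// ge0_fin_numE.
Qed.

Lemma Rintegral_fubini1 C (f : T1 -> T2 -> R) :
  bounded_by C (fun z => f z.1 z.2) ->
  \int[m1]_(x in D1) \int[m2]_(y in D2) f x y =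
  \int[(m1 \x m2)%E]_(z in D1 `*` D2) f z.1 z.2.
Proof.
move=> bf; rewrite [RHS]Rintegral_mkcond /Rintegral -integral12_prod_meas1.
  rewrite integral_mkcond; congr fine; apply: eq_integral => x _.
  rewrite patchE /fubini_F; case: ifPn => xD1.
    rewrite fineK; last first.
      apply: integrable_fin_num => //.
      exact: bounded_by_integrable (bounded_by_pair1 x bf).
    rewrite integral_mkcond; apply: eq_integral => y _.
    rewrite !patchE/= in_setX/= xD1/=; by case: ifP.
  rewrite integral0_eq// => y _; rewrite patchE in_setX/=.
  by rewrite (negbTE xD1).
exact: cut bf.
Qed.

Lemma Rintegral_fubini2 C (f : T1 -> T2 -> R) :
  bounded_by C (fun z => f z.1 z.2) ->
  \int[m2]_(y in D2) \int[m1]_(x in D1) f x y =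
  \int[(m1 \x m2)%E]_(z in D1 `*` D2) f z.1 z.2.
Proof.
move=> bf; rewrite [RHS]Rintegral_mkcond /Rintegral -integral21_prod_meas1.
  rewrite integral_mkcond; congr fine; apply: eq_integral => y _.
  rewrite patchE /fubini_G; case: ifPn => yD2.
    rewrite fineK; last first.
      apply: integrable_fin_num => //.
      exact: bounded_by_integrable (bounded_by_pair2 y bf).
    rewrite integral_mkcond; apply: eq_integral => x _.
    rewrite !patchE/= in_setX/= yD2 andbT; by case: ifP.
  rewrite integral0_eq// => x _; rewrite patchE in_setX/=.
  by rewrite (negbTE yD2) andbF.
exact: cut bf.
Qed.

Lemma Rintegral_swap C (f : T1 -> T2 -> R) :
  bounded_by C (fun z => f z.1 z.2) ->
  \int[m1]_(x in D1) \int[m2]_(y in D2) f x y =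
  \int[m2]_(y in D2) \int[m1]_(x in D1) f x y.
Proof.
by move=> bf; rewrite (Rintegral_fubini1 bf) -(Rintegral_fubini2 bf).
Qed.

End fubini_bounded.

(** * Integrals over intervals of the line *)

Section lebesgue_interval.
Context (R : realType).
Notation leb := (@lebesgue_measure R).
Implicit Types (F : R -> R) (a b c C K : R).

Lemma lebesgue_itv_lty (a b : itv_bound R) :
  a != -oo%O -> b != +oo%O -> (leb [set` Interval a b] < +oo)%E.
Proof.
move: a b => [ba a|[//|]] [bb b|[|//]] _ _; rewrite lebesgue_measure_itv//=;
  case: ifPn => //=; rewrite ?ltNge ?leey ?leNye//= => _.
Qed.

Lemma fine_lebesgue_itv a b : a <= b -> fine (leb `[a, b]) = b - a.
Proof.
move=> ab; rewrite lebesgue_measure_itv/= lte_fin; case: ltP => //= ba.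
by rewrite (@le_anti _ _ a b) ?ab ?subrr.
Qed.

Lemma itv_integrable C F (i : interval R) : bounded_by C F ->
  (leb [set` i] < +oo)%E -> leb.-integrable [set` i] (EFin \o F).
Proof.
move=> bF ioo; apply: (bounded_by_integrable _ ioo bF); exact: measurable_itv.
Qed.

Lemma le_norm_itv_in C K F a b : a <= b -> bounded_by C F ->
  (forall x, a <= x <= b -> `|F x| <= K) ->
  `|\int[leb]_(x in `[a, b]) F x| <= K * (b - a).
Proof.
move=> ab bF FK; rewrite -fine_lebesgue_itv//.
apply: (@le_norm_Rintegral_in _ (measurableTypeR R) R leb C K F).
- exact: measurable_itv.
- exact: lebesgue_itv_lty.
- exact: bF.
- by move=> x; rewrite /= in_itv; exact: FK.
Qed.

Lemma le_norm_itv C F a b : a <= b -> bounded_by C F ->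
  `|\int[leb]_(x in `[a, b]) F x| <= C * (b - a).
Proof.
by move=> ab bF; apply: (le_norm_itv_in ab bF) => x _; exact: bF.2.
Qed.

Lemma Rintegral_itvD C F a b c : bounded_by C F -> a <= b -> b <= c ->
  \int[leb]_(x in `[a, c]) F x =
  \int[leb]_(x in `[a, b]) F x + \int[leb]_(x in `[b, c]) F x.
Proof.
move=> bF ab bc.
have int i j : leb.-integrable `[i, j] (EFin \o F).
  by apply: itv_integrable bF _; exact: lebesgue_itv_lty.
apply/eqP; rewrite addrC -subr_eq Rintegral_itvB ?bnd_simp//.
rewrite Rintegral_itv_obnd_cbnd//.
by apply: itv_integrable bF _; exact: lebesgue_itv_lty.
Qed.

Let shift w : R -> measurableTypeR R := fun u => u + w.

Let measurable_shift w : measurable_fun [set: measurableTypeR R] (shift w).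
Proof. exact: (@measurable_funD _ R R). Qed.

Lemma lebesgue_measure_translation (w : R) (A : set R) : measurable A ->
  leb A = pushforward leb (shift w) A.
Proof.
move=> mA; apply: lebesgue_measure_unique => //= _ [[c d] _ <-].
rewrite /pushforward.
rewrite (_ : _ @^-1` _ = `](c - w), (d - w)]%classic); last first.
  by apply/seteqP; split => x /=; rewrite !in_itv/= ltrBlDr lerBrDr.
rewrite !lebesgue_measure_itv/= !lte_fin ltrD2r; case: ifP => // _.
by rewrite -!EFinD; congr EFin; ring.
Qed.

Lemma Rintegral_translation C F a b w : bounded_by C F ->
  \int[leb]_(u in `[a, b]) F (u + w) = \int[leb]_(u in `[a + w, b + w]) F u.
Proof.
move=> bF.
have wab : shift w @^-1` `[a + w, b + w]%classic = `[a, b]%classic.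
  by apply/seteqP; split => x /=; rewrite /shift !in_itv/= !lerD2r.
rewrite /Rintegral; congr fine.
transitivity (\int[pushforward leb (shift w)]_(u in `[(a + w)%R, (b + w)%R])
    (F u)%:E)%E; last first.
  apply: eq_measure_integral => A mA _.
  exact: esym (lebesgue_measure_translation w mA).
rewrite integral_pushforward//.
- by rewrite wab.
- by apply/measurable_EFinP; case: bF.
- rewrite wab; apply: (@itv_integrable C (F \o shift w)).
    exact: (bounded_by_comp (measurable_shift w) bF).
  exact: lebesgue_itv_lty.
Qed.

Lemma integral_double a b : 0 <= a -> a <= b ->
  (\int[leb]_(z in `]a, b]) (2 * z)%:E = (b ^+ 2 - a ^+ 2)%:E)%E.
Proof.
move=> a0; rewrite le_eqVlt => /predU1P[<-|ab].
  by rewrite set_itvoc0 integral_set0 subrr.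
rewrite integral_itv_obnd_cbnd; last first.
  by apply/measurable_EFinP; apply: measurable_funM.
have dsq (z : R) : is_derive z (1 : R) (fun z : R => z ^+ 2) (2 * z).
  by apply: is_derive_eq; rewrite /GRing.scale/=; ring.
rewrite (continuous_FTC2 ab (F := fun z => z ^+ 2))//.
- apply: continuous_subspaceT => z; apply: cvgM; first exact: cvg_cst.
  exact: cvg_id.
- have csq (z : R) : {for z, continuous (fun z : R => z ^+ 2)}.
    by apply/differentiable_continuous/derivable1_diffP.
  split.
  + by move=> z _; exact: ex_derive.
  + exact/cvg_at_right_filter/csq.
  + exact/cvg_at_left_filter/csq.
- by move=> z _; rewrite derive1E derive_val.
Qed.

End lebesgue_interval.

(** * Substitution of a square in a measurable integrand *)

Section square_substitution.
Context (R : realType) (a b : R) (a0 : 0 < a) (ab : a <= b).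
Notation leb := (@lebesgue_measure R).
Notation RT := (measurableTypeR R).

Let D : set RT := `]a ^+ 2, b ^+ 2]%classic.

Let mD : measurable D. Proof. exact: measurable_itv. Qed.

Let Q : set (RT * RT) := [set p | a < p.1 <= b /\ 0 <= p.2 <= 2 * p.1].

Let mQ : measurable Q.
Proof.
rewrite (_ : Q = (fst @^-1` `]a, b]%classic `&`
    (snd @^-1` `[0, +oo[%classic `&`
     (fun p : RT * RT => 2 * p.1 - p.2) @^-1` `[0, +oo[%classic))).
  apply: measurableI; last apply: measurableI;
    rewrite -[X in measurable X]setTI.
  - by apply: (@measurable_fst _ _ RT RT) => //; exact: measurable_itv.
  - by apply: (@measurable_snd _ _ RT RT) => //; exact: measurable_itv.
  - have mf : measurable_fun setT (fun p : RT * RT => (2 * p.1 - p.2 : R)).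
      apply: (@measurable_funB _ _ R); last exact: measurable_snd.
      by apply: (@measurable_funM _ _ R) => //; exact: measurable_fst.
    by apply: mf => //; exact: measurable_itv.
apply/seteqP; split => -[z y] /=; rewrite !in_itv/= !andbT subr_ge0.
  by move=> [zab /andP[y0 yz]].
by move=> [zab [y0 yz]]; split=> //; apply/andP.
Qed.

(* The points outside Q go to 0, which is not in D. *)
Let sq : RT * RT -> RT := (fun p => p.1 ^+ 2) \_ Q.

Let msq : measurable_fun setT sq.
Proof.
apply/(measurable_restrictT _ mQ); apply: measurable_funTS.
by apply: (@measurable_funX _ _ R); exact: measurable_fst.
Qed.

Let sq_preimage A : A `<=` D -> sq @^-1` A = Q `&` (fun p => A (p.1 ^+ 2)).
Proof.
move=> AD; apply/seteqP; split => p /=; rewrite /sq patchE; last first.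
  by move=> [Qp Ap]; rewrite mem_set.
case: ifPn => [/set_mem//|_ /AD]; rewrite /D/= in_itv/=.
by rewrite ltNge sqr_ge0.
Qed.

Let area (c d : R) : 0 < c -> c <= d ->
  (product_measure1 leb leb)
     [set p : RT * RT | Num.sqrt c < p.1 <= Num.sqrt d /\ 0 <= p.2 <= 2 * p.1] =
  (d - c)%:E.
Proof.
move=> c0 cd; rewrite /product_measure1/=.
transitivity (\int[leb]_(z in `]Num.sqrt c, Num.sqrt d]) (2 * z)%:E)%E; last first.
  rewrite integral_double ?sqrtr_ge0 ?ler_sqrt//; last exact: le_trans (ltW c0) cd.
  by rewrite !sqr_sqrtr// ?(ltW c0)// (le_trans _ cd)// ltW.
rewrite [RHS]integral_mkcond; apply: eq_integral => z _ /=.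
rewrite patchE; case: ifPn => [|zcd].
  rewrite inE/= in_itv/= => zcd.
  have z0 : 0 < z by case/andP: zcd => /(le_lt_trans (sqrtr_ge0 _)).
  rewrite (_ : xsection _ _ = `[0, 2 * z]%classic).
    by rewrite lebesgue_measure_itv/= lte_fin mulr_gt0// sube0.
  apply/seteqP; split => y /=; rewrite /xsection/= inE/= in_itv/=.
    by case.
  by move=> yz; split.
rewrite (_ : xsection _ _ = set0) ?measure0//.
apply/seteqP; split => y //=; rewrite /xsection/= inE/= => -[zcd' _].
by move/negP : zcd; apply; rewrite inE/= in_itv.
Qed.

Let nu : {measure set RT -> \bar R} :=
  measure_function_pushforward__canonical__measure_function_Measure
    (product_measure1 leb leb) msq.

Let lebesgue_sq A : measurable A -> A `<=` D ->
  leb A = nu A.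
Proof.
move=> mA AD.
have mDC : measurable (~` D) by exact: measurableC.
have leb_ocitv : forall B : set RT, ocitv B ->
    leb B = measure_add (mrestr nu mD) (mrestr leb mDC) B.
  move=> _ [[c d] _ <-].
  rewrite measure_addE /= /mrestr.
  have -> : leb `]c, d]%classic =
      (leb (`]c, d]%classic `&` D) + leb (`]c, d]%classic `&` ~` D))%E.
    have mcd : (R.-ocitv.-measurable).-sigma.-measurable `]c, d]%classic.
      exact: measurable_itv.
    rewrite -measureU//; last 3 first.
    - exact: measurableI.
    - exact: measurableI.
    - by rewrite setIACA setICr setI0.
    by rewrite -setIUr setUv setIT.
  congr (_ + _)%E.
  rewrite /nu/= /pushforward sq_preimage; last exact: subIsetr.
  pose c1 := Num.max c (a ^+ 2); pose d1 := Num.min d (b ^+ 2).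
  have a20 : 0 < a ^+ 2 by rewrite exprn_gt0.
  have c10 : 0 < c1 by rewrite lt_max a20 orbT.
  have -> : `]c, d]%classic `&` D = `]c1, d1]%classic.
    apply/seteqP; split => x; rewrite /D/= !in_itv/= gt_max le_min.
      by move=> [/andP[-> ->] /andP[-> ->]].
    by move=> /andP[/andP[-> ->] /andP[-> ->]].
  have [cd|dc] := leP c1 d1; last first.
    rewrite set_itv_ge ?measure0 -?leNgt ?bnd_simp ?ltW//.
    rewrite (_ : _ `&` _ = set0) ?measure0//.
    by apply/seteqP; split => p //= [_].
  rewrite lebesgue_measure_itv/= lte_fin.
  transitivity ((d1 - c1)%:E).
    case: ltP => // dc; rewrite (@le_anti _ _ c1 d1) ?cd ?dc//.
    by rewrite subrr.
  rewrite -area//; congr product_measure1.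
  have d10 : 0 <= d1 by rewrite (le_trans _ cd)// ltW.
  apply/seteqP; split => -[z y] /=.
    rewrite in_itv/= => -[zcd yz].
    have z0 : 0 < z by case/andP: zcd => /(le_lt_trans (sqrtr_ge0 _)).
    move: zcd; rewrite -[z in X in X -> _](ger0_norm (ltW z0)) -sqrtr_sqr.
    rewrite ltr_sqrt ?exprn_gt0// ler_sqrt//.
    rewrite gt_max le_min => /andP[/andP[cz az] /andP[zd zb]].
    split; last by rewrite cz az zd zb.
    have b0 : 0 < b by exact: lt_le_trans ab.
    split=> //=; apply/andP; split.
      by rewrite ltNge; apply/negP => za; nra.
    by rewrite leNgt; apply/negP => za; nra.
  move=> [[/andP[az zb] yz]]; rewrite in_itv/= => zcd; split=> //.
  have z0 : 0 < z by exact: lt_trans az.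
  rewrite -[z](ger0_norm (ltW z0)) -sqrtr_sqr.
  by rewrite ltr_sqrt ?exprn_gt0// ler_sqrt.
have : leb A = measure_add (mrestr nu mD) (mrestr leb mDC) A.
  exact: lebesgue_measure_unique leb_ocitv _ mA.
rewrite measure_addE /= /mrestr (setIidl AD).
rewrite (_ : A `&` ~` D = set0) ?measure0 ?adde0//.
by apply/seteqP; split => x //= [/AD].
Qed.

(** As H is only measurable, it has no antiderivative to work with. Instead, 2 z
    is the length of the vertical section at z of the region below the graph of
    z |-> 2 z, and squaring the abscissa carries area on this region to length
    on ]a^2, b^2]. For an interval this is the computation of an integral of
    2 z, and a Borel measure on the line is determined by its values on
    intervals. *)
Lemma Rintegral_square C (H : R -> R) : bounded_by C H ->
  \int[leb]_(u in `[a ^+ 2, b ^+ 2]) H u =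
  \int[leb]_(z in `[a, b]) (2 * z * H (z ^+ 2)).
Proof.
move=> bH; have [mH HC] := bH.
have Doo : (leb D < +oo)%E by exact: lebesgue_itv_lty.
have iH : leb.-integrable D (EFin \o H) by exact: itv_integrable bH _.
rewrite -[LHS]Rintegral_itv_obnd_cbnd//.
pose h (z y : R) := H (z ^+ 2) * \1_[set p : RT * RT | p.2 <= 2 * p.1] (z, y).
have mle : measurable [set p : RT * RT | p.2 <= 2 * p.1].
  rewrite (_ : mkset _ = (fun p : RT * RT => 2 * p.1 - p.2) @^-1` `[0, +oo[%classic).
    rewrite -[X in measurable X]setTI.
    have mf : measurable_fun setT (fun p : RT * RT => (2 * p.1 - p.2 : R)).
      apply: (@measurable_funB _ _ R); last exact: measurable_snd.
      by apply: (@measurable_funM _ _ R) => //; exact: measurable_fst.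
    by apply: mf => //; exact: measurable_itv.
  by apply/seteqP; split => p /=; rewrite in_itv/= andbT subr_ge0.
have bh : bounded_by (C * 1) (fun p : RT * RT => h p.1 p.2).
  apply: bounded_byM.
    apply: (bounded_by_comp _ bH).
    by apply: (@measurable_funX _ _ R); exact: measurable_fst.
  split=> [|p]; last first.
    by rewrite indicE; case: (_ \in _); rewrite ?normr1 ?normr0.
  rewrite (_ : (fun _ => _) = \1_[set p : RT * RT | p.2 <= 2 * p.1]).
    exact: measurable_indic.
  by apply/funext => -[].
have Qoo : (product_measure1 leb leb Q < +oo)%E.
  rewrite (_ : Q = [set p : RT * RT | Num.sqrt (a ^+ 2) < p.1 <= Num.sqrt (b ^+ 2)
      /\ 0 <= p.2 <= 2 * p.1]); last first.
    by rewrite !sqrtr_sqr !ger0_norm// ?(ltW a0)// (le_trans (ltW a0)).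
  rewrite area ?ltry// ?exprn_gt0//.
  by rewrite ler_pXn2r// ?nnegrE ?(ltW a0)// (le_trans (ltW a0)).
transitivity (\int[product_measure1 leb leb]_(p in Q) H (p.1 ^+ 2)).
  rewrite /Rintegral; congr fine.
  transitivity (\int[nu]_(u in D) (H u)%:E)%E.
    by apply: eq_measure_integral => A mA AD; exact: lebesgue_sq.
  have sqD : sq @^-1` D = Q.
    rewrite sq_preimage//; apply/setIidl => -[z y] [/= /andP[az zb] _].
    rewrite /D/= in_itv/= ltr_pXn2r ?nnegrE ?ler_pXn2r ?nnegrE ?az ?zb//;
      by rewrite ?ltW// (lt_trans a0)// (lt_le_trans az).
  rewrite integral_pushforward//.
  - rewrite sqD; apply: eq_integral => p pQ /=; rewrite /sq patchE.
    by rewrite pQ.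
  - exact/measurable_EFinP.
  - rewrite sqD; apply: (bounded_by_integrable _ Qoo (bounded_by_comp msq bH)).
    exact: mQ.
rewrite -[RHS]Rintegral_itv_obnd_cbnd; last first.
  apply: measurable_bounded_integrable.
  - exact: measurable_itv.
  - exact: lebesgue_itv_lty.
  - apply: measurable_funTS; apply: (@measurable_funM _ _ R).
      exact: (@measurable_funM _ _ R).
    by apply: measurableT_comp mH _; exact: (@measurable_funX _ _ R).
  - exists (2 * b * C); split; first exact: num_real.
    move=> M bCM z; rewrite /= in_itv/= => /andP[az zb].
    apply: le_trans (ltW bCM).
    rewrite normrM ler_pM// normrM normr_nat ler_pM2l//.
    by rewrite gtr0_norm// (lt_trans a0).
transitivity (\int[leb]_(z in `]a, b]) \int[leb]_(y in `[0, 2 * b]) h z y); last first.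
  apply: eq_Rintegral => z; rewrite inE/= in_itv/= => /andP[az zb].
  have z0 : 0 <= z by rewrite ltW// (lt_trans a0).
  transitivity (\int[leb]_(y in `[0, 2 * b] `&` [set y | y <= 2 * z]) (H (z ^+ 2))).
    rewrite Rintegral_mkcondr; apply: eq_Rintegral => y _.
    rewrite /h patchE indicE/=; case: ifPn => yz.
      by rewrite mem_set ?mulr1//; move: yz; rewrite inE.
    by rewrite memNset ?mulr0//; move: yz; rewrite notin_setE.
  rewrite (_ : _ `&` _ = `[0, 2 * z]%classic).
    rewrite Rintegral_cst; last exact: measurable_itv.
    by rewrite fine_lebesgue_itv ?subr0 ?mulr_ge0// mulrC.
  apply/seteqP; split => y /=; rewrite !in_itv/=.
    by move=> [/andP[-> _] ->].
  move=> /andP[-> yz]; split=> //=.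
  by rewrite (le_trans yz)// ler_pM2l.
rewrite (Rintegral_fubini1 _ _ _ _ bh); last 4 first.
- exact: measurable_itv.
- exact: measurable_itv.
- exact: lebesgue_itv_lty.
- exact: lebesgue_itv_lty.
rewrite (_ : Q = (`]a, b]%classic `*` `[0, 2 * b]%classic) `&`
    [set p : RT * RT | p.2 <= 2 * p.1]).
  rewrite Rintegral_mkcondr; apply: eq_Rintegral => -[z y] _.
  by rewrite /h patchE indicE/=; case: ifP; rewrite ?mulr1 ?mulr0.
apply/seteqP; split => -[z y] /=; rewrite !in_itv/=.
  move=> [/andP[az zb] /andP[y0 yz]]; rewrite az zb y0 yz/=; split=> //.
  by split=> //; rewrite (le_trans yz)// ler_pM2l.
by move=> [[zab /andP[y0 _]] yz]; split=> //; rewrite y0.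
Qed.

End square_substitution.

(** * Smoothing along a quadratic phase *)

Section quadratic_phase.
Context (R : realType).
Notation leb := (@lebesgue_measure R).
Notation RT := (measurableTypeR R).
Implicit Types (W G F : R -> R) (a b q L B C K : R).

Lemma bounded_by_add2 C G : bounded_by C G ->
  bounded_by C (fun p : RT * RT => G (p.1 + p.2)).
Proof.
move=> bG; apply: (bounded_by_comp (u := fun p : RT * RT => p.1 + p.2 : R)) bG.
by apply: (@measurable_funD _ _ R); [exact: measurable_fst|exact: measurable_snd].
Qed.

Lemma bounded_by_shift C G w : bounded_by C G ->
  bounded_by C (fun u : R => G (u + w)).
Proof. by apply: bounded_by_comp; exact: measurable_funD. Qed.

Lemma bounded_by_window C G L : 0 <= L -> bounded_by C G ->
  bounded_by (C * L) (fun u : R => \int[leb]_(w in `[0, L]) G (u + w)).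
Proof.
move=> L0 bG; rewrite -[L in C * L]subr0 -fine_lebesgue_itv//.
apply: (@bounded_by_Rintegral _ _ RT RT R leb `[0, L]%classic
  (measurable_itv _) (lebesgue_itv_lty _ _) C (fun u w => G (u + w))) => //.
exact: bounded_by_add2.
Qed.

Lemma ler_Rintegral_itv C C' F G a b : bounded_by C F -> bounded_by C' G ->
  (forall x, a <= x <= b -> F x <= G x) ->
  \int[leb]_(x in `[a, b]) F x <= \int[leb]_(x in `[a, b]) G x.
Proof.
move=> bF bG FG; apply: le_Rintegral => [//| | |x/=].
- by apply: itv_integrable bF _; exact: lebesgue_itv_lty.
- by apply: itv_integrable bG _; exact: lebesgue_itv_lty.
- by rewrite in_itv/=; exact: FG.
Qed.

Lemma RintegralB_itv C C' F G a b : bounded_by C F -> bounded_by C' G ->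
  \int[leb]_(x in `[a, b]) (F x - G x) =
  \int[leb]_(x in `[a, b]) F x - \int[leb]_(x in `[a, b]) G x.
Proof.
move=> bF bG; rewrite RintegralB//.
- by apply: itv_integrable bF _; exact: lebesgue_itv_lty.
- by apply: itv_integrable bG _; exact: lebesgue_itv_lty.
Qed.

Lemma RintegralZ_itv C F r a b : bounded_by C F ->
  \int[leb]_(x in `[a, b]) (r * F x) = r * \int[leb]_(x in `[a, b]) F x.
Proof.
move=> bF; rewrite RintegralZl//.
by apply: itv_integrable bF _; exact: lebesgue_itv_lty.
Qed.

Lemma Rintegral_cst_itv r a b : a <= b ->
  \int[leb]_(x in `[a, b]) r = r * (b - a).
Proof.
by move=> ab; rewrite Rintegral_cst ?fine_lebesgue_itv//; exact: measurable_itv.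
Qed.

(** W hardly changes under a translation by w in [0, L], so the integral of
    W u * G u is close to that of W u * G (u + w). Averaging over w replaces G
    by its means over windows of length L. The error consists of the two ends of
    [a, b] and of the variation of W. *)
Lemma window_smoothing B K C W G a b L : 0 < L -> a <= b ->
  bounded_by B W -> (forall x y, `|W x - W y| <= K * `|x - y|) ->
  bounded_by C G ->
  L * `|\int[leb]_(u in `[a, b]) (W u * G u)| <=
    B * \int[leb]_(u in `[a, b]) `|\int[leb]_(w in `[0, L]) G (u + w)|
    + L ^+ 2 * (2 * B * C + K * C * (b - a)).
Proof.
move=> L0 ab bW KW bG.
have B0 : 0 <= B := bounded_by_ge0 (0 : R) bW.
have C0 : 0 <= C := bounded_by_ge0 (0 : R) bG.
have K0 : 0 <= K.
  by have := KW 1 0; rewrite subr0 normr1 mulr1; exact: le_trans.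
have bWG := bounded_byM bW bG.
have bWGw w := bounded_byM bW (bounded_by_shift w bG).
set I := \int[leb]_(u in `[a, b]) (W u * G u).
have shift_error w : 0 <= w -> w <= L ->
    `|I - \int[leb]_(u in `[a, b]) (W u * G (u + w))| <=
    L * (2 * B * C + K * C * (b - a)).
  move=> w0 wL.
  set J := \int[leb]_(u in `[a, b]) (W (u + w) * G (u + w)).
  have JE : I + \int[leb]_(u in `[b, b + w]) (W u * G u) =
      \int[leb]_(u in `[a, a + w]) (W u * G u) + J.
    rewrite /J (@Rintegral_translation _ (B * C) (fun u => W u * G u))//.
    by rewrite -!(Rintegral_itvD bWG) ?lerDl ?lerD2r.
  have IJ : `|I - J| <= w * (2 * B * C).
    have -> : I - J = \int[leb]_(u in `[a, a + w]) (W u * G u) -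
                      \int[leb]_(u in `[b, b + w]) (W u * G u).
      by apply/eqP; rewrite subr_eq addrAC -subr_eq opprK JE.
    apply: le_trans (ler_normB _ _) _.
    have -> : w * (2 * B * C) = B * C * (a + w - a) + B * C * (b + w - b) by ring.
    by apply: lerD; apply: (le_norm_itv _ bWG); rewrite lerDl.
  have JW : `|J - \int[leb]_(u in `[a, b]) (W u * G (u + w))| <=
      K * w * C * (b - a).
    rewrite -(RintegralB_itv _ _ (bounded_by_shift w bWG) (bWGw w)).
    apply: (le_norm_itv_in ab (bounded_byB (bounded_by_shift w bWG) (bWGw w))).
    move=> u _; rewrite -mulrBl normrM ler_pM//; last exact: bG.2.
    by apply: le_trans (KW _ _) _; rewrite addrAC subrr add0r (ger0_norm w0).
  apply: (@le_trans _ _ (w * (2 * B * C) + K * w * C * (b - a))).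
    by rewrite -[X in `|X|](subrKA J); apply: le_trans (ler_normD _ _) (lerD IJ JW).
  have -> : w * (2 * B * C) + K * w * C * (b - a) =
    w * (2 * B * C + K * C * (b - a)) by ring.
  rewrite ler_wpM2r// addr_ge0 ?mulr_ge0//.
  by rewrite subr_ge0.
pose WGw := fun w u : R => W u * G (u + w).
have bWGw2 : bounded_by (B * C) (fun p : RT * RT => WGw p.1 p.2).
  apply: bounded_byM.
    by apply: bounded_by_comp bW; exact: measurable_snd.
  have := bounded_by_add2 bG.
  rewrite (_ : (fun p : RT * RT => G (p.1 + p.2)) = (fun p => G (p.2 + p.1)))//.
  by apply/funext => p; rewrite addrC.
have bint : bounded_by (B * C * (b - a))
    (fun w => \int[leb]_(u in `[a, b]) WGw w u).
  rewrite -fine_lebesgue_itv//.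
  exact: (@bounded_by_Rintegral _ _ RT RT R leb `[a, b]%classic
    (measurable_itv _) (lebesgue_itv_lty _ _) (B * C) WGw).
have LI : `|L * I - \int[leb]_(w in `[0, L]) \int[leb]_(u in `[a, b]) WGw w u| <=
    L ^+ 2 * (2 * B * C + K * C * (b - a)).
  have -> : L * I = \int[leb]_(w in `[0, L]) I.
    by rewrite Rintegral_cst_itv ?subr0 1?mulrC// ltW.
  rewrite -(RintegralB_itv _ _ (bounded_by_cst _ I) bint).
  rewrite expr2 -mulrA mulrC -[X in _ * X]subr0.
  apply: (le_norm_itv_in _ (bounded_byB (bounded_by_cst _ I) bint)).
    exact: ltW.
  by move=> w /andP[]; exact: shift_error.
have swapE : \int[leb]_(w in `[0, L]) \int[leb]_(u in `[a, b]) WGw w u =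
    \int[leb]_(u in `[a, b]) (W u * \int[leb]_(w in `[0, L]) G (u + w)).
  rewrite (@Rintegral_swap _ _ RT RT R leb leb _ _ _ _ _ _ _ _ bWGw2); first last.
  - exact: lebesgue_itv_lty.
  - exact: lebesgue_itv_lty.
  - exact: measurable_itv.
  - exact: measurable_itv.
  apply: eq_Rintegral => u _; rewrite -(@RintegralZ_itv C)//.
  have := bounded_by_shift u bG.
  by under [X in bounded_by _ X]eq_fun do rewrite addrC.
have bwin := bounded_by_window (ltW L0) bG.
have main : `|\int[leb]_(w in `[0, L]) \int[leb]_(u in `[a, b]) WGw w u| <=
    B * \int[leb]_(u in `[a, b]) `|\int[leb]_(w in `[0, L]) G (u + w)|.
  rewrite swapE; apply: le_trans (le_normr_Rintegral _ _) _ => //.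
    apply: (itv_integrable (bounded_byM bW bwin)); exact: lebesgue_itv_lty.
  rewrite -(RintegralZ_itv _ _ _ (bounded_by_norm bwin)).
  apply: (ler_Rintegral_itv (bounded_by_norm (bounded_byM bW bwin))
     (bounded_byM (bounded_by_cst _ B) (bounded_by_norm bwin))).
  move=> u _; rewrite normrM ler_wpM2r//; exact: bW.2.
rewrite -[L in L * _](ger0_norm (ltW L0)) -normrM.
rewrite -[X in `|X|](subrK (\int[leb]_(w in `[0, L])
  \int[leb]_(u in `[a, b]) WGw w u)) addrC [leRHS]addrC.
rewrite [X in `|X|]addrC.
exact: le_trans (ler_normD _ _) (lerD LI main).
Qed.

End quadratic_phase.

Section quadratic_phase.
Context (R : realType).
Notation leb := (@lebesgue_measure R).
Notation RT := (measurableTypeR R).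
Implicit Types (Phi G F : R -> R) (a b q L B C K : R).

Lemma lipschitz_measurable K F : (forall x y, `|F x - F y| <= K * `|x - y|) ->
  measurable_fun [set: R] F.
Proof.
move=> KF; apply: continuous_measurable_fun => x.
have K0 : 0 <= K.
  by have := KF 1 0; rewrite subr0 normr1 mulr1; exact: le_trans.
apply/cvgrPdist_lt => e e0; near=> t.
apply: le_lt_trans (KF _ _) _.
apply: (@le_lt_trans _ _ ((K + 1) * `|x - t|)); first by rewrite ler_wpM2r ?lerDl.
rewrite mulrC -ltr_pdivlMr ?ltr_wpDl//.
near: t; apply: (@cvgr_dist_lt _ _ _ (nbhs x) _ id x) => //.
by rewrite divr_gt0// ltr_wpDl.
Unshelve. all: by end_near. Qed.

Lemma lipschitz_sqrt_max a (u v : R) : 0 < a ->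
  `|Num.sqrt (Num.max u (a ^+ 2)) - Num.sqrt (Num.max v (a ^+ 2))| <=
    (2 * a)^-1 * `|u - v|.
Proof.
move=> a0; set x := Num.max u _; set y := Num.max v _.
have a20 : 0 < a ^+ 2 by rewrite exprn_gt0.
have xa : a ^+ 2 <= x by rewrite le_max lexx orbT.
have ya : a ^+ 2 <= y by rewrite le_max lexx orbT.
have sx : a <= Num.sqrt x.
  by rewrite -[leLHS](ger0_norm (ltW a0)) -sqrtr_sqr ler_wsqrtr.
have sy : a <= Num.sqrt y.
  by rewrite -[leLHS](ger0_norm (ltW a0)) -sqrtr_sqr ler_wsqrtr.
have xy : `|x - y| <= `|u - v|.
  rewrite /x /y /Num.max; case: ifPn => ua; case: ifPn => va.
  - by rewrite subrr normr0.
  - move: va; rewrite -leNgt => va; rewrite [leLHS]distrC [leRHS]distrC.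
    by rewrite !ger0_norm ?subr_ge0// ?lerB// ?(ltW ua)// (le_trans (ltW ua)).
  - move: ua; rewrite -leNgt => ua.
    by rewrite !ger0_norm ?subr_ge0// ?lerB// ?(ltW va)// (le_trans (ltW va)).
  - by [].
rewrite ler_pdivlMl ?mulr_gt0//; apply: le_trans xy.
have -> : x - y = (Num.sqrt x + Num.sqrt y) * (Num.sqrt x - Num.sqrt y).
  rewrite -[in LHS](@sqr_sqrtr _ x) ?(le_trans (ltW a20))//.
  by rewrite -[in LHS](@sqr_sqrtr _ y) ?(le_trans (ltW a20))//; ring.
rewrite normrM ler_wpM2r// ger0_norm ?addr_ge0 ?sqrtr_ge0//.
by rewrite mulr2n mulrDl mul1r lerD.
Qed.

(** The substitution u = z^2 turns the integral into that of W u * G (u + q), with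
    W u = Phi (sqrt u) / (2 sqrt u). When a and b are of order M, the weight W is
    of order 1 / M and its Lipschitz constant of order 1 / M^2; as the interval
    has length of order M^2, replacing G by its window means costs only O(1),
    while the trivial bound of the integral is of order M. *)
Lemma quadratic_phase_bound C C' K Phi G a b q L :
  0 < L -> 0 < a -> a <= b ->
  bounded_by C Phi -> (forall x y, `|Phi x - Phi y| <= K * `|x - y|) ->
  bounded_by C' G ->
  L * `|\int[leb]_(z in `[a, b]) (Phi z * G (z ^+ 2 + q))| <=
    C / (2 * a) * \int[leb]_(u in `[a ^+ 2 + q, b ^+ 2 + q])
      `|\int[leb]_(w in `[0, L]) G (u + w)|
    + L ^+ 2 * (2 * (C / (2 * a)) * C' +
       (K / (4 * a ^+ 2) + C / (4 * a ^+ 3)) * C' * (b ^+ 2 - a ^+ 2)).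
Proof.
move=> L0 a0 ab bPhi KPhi bG.
have C0 : 0 <= C := bounded_by_ge0 (0 : R) bPhi.
have K0 : 0 <= K.
  by have := KPhi 1 0; rewrite subr0 normr1 mulr1; exact: le_trans.
(* s extends the square root from [a^2, oo[ to a Lipschitz function. *)
pose s (u : R) := Num.sqrt (Num.max u (a ^+ 2)).
have sa u : a <= s u.
  rewrite -[leLHS](ger0_norm (ltW a0)) -sqrtr_sqr ler_wsqrtr//.
  by rewrite le_max lexx orbT.
have s0 u : 0 < s u := lt_le_trans a0 (sa u).
have sqs z : a <= z -> s (z ^+ 2) = z.
  move=> az; have z0 : 0 <= z := le_trans (ltW a0) az.
  rewrite /s max_l ?ler_pXn2r ?nnegrE ?(ltW a0)//.
  by rewrite sqrtr_sqr ger0_norm.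
pose W u := Phi (s u) / (2 * s u).
have KW u v : `|W u - W v| <= (K / (4 * a ^+ 2) + C / (4 * a ^+ 3)) * `|u - v|.
  have inv_lip : `|(s u)^-1 - (s v)^-1| <= (a ^+ 2)^-1 * `|s u - s v|.
    have -> : (s u)^-1 - (s v)^-1 = (s u * s v)^-1 * (s v - s u).
      by field; rewrite !gt_eqF.
    have suv0 : 0 < s u * s v by rewrite mulr_gt0.
    rewrite normrM distrC ler_wpM2r// ger0_norm ?invr_ge0 ?(ltW suv0)//.
    by rewrite lef_pV2 ?posrE ?exprn_gt0// expr2 ler_pM// ltW.
  have -> : W u - W v = (2 * s u)^-1 * (Phi (s u) - Phi (s v)) +
      Phi (s v) / 2 * ((s u)^-1 - (s v)^-1).
    by rewrite /W; field; rewrite !gt_eqF.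
  have suv := lipschitz_sqrt_max u v a0; rewrite -/(s u) -/(s v) in suv.
  apply: (@le_trans _ _ ((K / (2 * a) + C / (2 * a ^+ 2)) * `|s u - s v|)).
    apply: le_trans (ler_normD _ _) _; rewrite [leRHS]mulrDl lerD//.
      rewrite normrM [leRHS]mulrAC [leLHS]mulrC ler_pM//.
      rewrite ger0_norm ?invr_ge0 ?mulr_ge0// ?(ltW (s0 _))//.
      by rewrite lef_pV2 ?posrE ?mulr_gt0// ler_pM2l.
    have -> : C / (2 * a ^+ 2) * `|s u - s v| = C / 2 * ((a ^+ 2)^-1 * `|s u - s v|).
      by field; rewrite gt_eqF.
    rewrite normrM ler_pM// normrM ler_pM//; first exact: bPhi.2.
    by rewrite ger0_norm.
  have -> : K / (4 * a ^+ 2) + C / (4 * a ^+ 3) =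
      (K / (2 * a) + C / (2 * a ^+ 2)) * (2 * a)^-1.
    by field; rewrite gt_eqF.
  rewrite -mulrA ler_wpM2l// addr_ge0// divr_ge0// mulr_ge0// ?exprn_ge0//;
    exact: ltW.
have bW : bounded_by (C / (2 * a)) W.
  split=> [|u]; first exact: lipschitz_measurable KW.
  rewrite /W normrM ler_pM//; first exact: bPhi.2.
  rewrite ger0_norm ?invr_ge0 ?mulr_ge0// ?(ltW (s0 _))//.
  by rewrite lef_pV2 ?posrE ?mulr_gt0// ler_pM2l.
have -> : \int[leb]_(z in `[a, b]) (Phi z * G (z ^+ 2 + q)) =
    \int[leb]_(u in `[a ^+ 2, b ^+ 2]) (W u * G (u + q)).
  rewrite (Rintegral_square a0 ab (bounded_byM bW (bounded_by_shift q bG))).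
  apply: eq_Rintegral => z; rewrite inE/= in_itv/= => /andP[az zb].
  rewrite /W sqs// mulrA; congr (_ * _); field.
  by rewrite gt_eqF// (lt_le_trans a0).
have a2b2 : a ^+ 2 <= b ^+ 2.
  by rewrite ler_pXn2r ?nnegrE ?(ltW a0)// (le_trans (ltW a0)).
apply: le_trans (window_smoothing L0 a2b2 bW KW (bounded_by_shift q bG)) _.
rewrite -(Rintegral_translation _ _ _
  (bounded_by_norm (bounded_by_window (ltW L0) bG))).
rewrite le_eqVlt; apply/orP; left; apply/eqP; congr (_ * _ + _).
apply: eq_Rintegral => u _; congr `|_|.
by apply: eq_Rintegral => w _; rewrite addrAC.
Qed.

End quadratic_phase.

(** * Integration over boxes along one coordinate *)

Section box.
Context (R : realType).
Notation leb := (@lebesgue_measure R).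
Notation RT := (measurableTypeR R).

Definition set_coord k (t : k.-tuple R) (j : 'I_k) (v : R) : k.-tuple R :=
  [tuple if i == j then v else tnth t i | i < k].

Lemma tnth_set_coord k (t : k.-tuple R) (j : 'I_k) v i :
  tnth (set_coord t j v) i = if i == j then v else tnth t i.
Proof. by rewrite tnth_mktuple. Qed.

Lemma set_coord0 k (t : k.-tuple R) s v :
  set_coord (cons_pair (s, t)) ord0 v = cons_pair (v, t).
Proof.
apply: eq_from_tnth => i; rewrite tnth_set_coord.
by case: (unliftP ord0 i) => [j ->|->]; rewrite ?eqxx ?tnth0//= !tnthS.
Qed.

Lemma set_coord_lift k (t : k.-tuple R) s (j : 'I_k) v :
  set_coord (cons_pair (s, t)) (lift ord0 j) v = cons_pair (s, set_coord t j v).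
Proof.
apply: eq_from_tnth => i; rewrite tnth_set_coord.
case: (unliftP ord0 i) => [i' ->|->]; last by rewrite !tnth0.
by rewrite (inj_eq lift_inj) !tnthS tnth_set_coord.
Qed.

Lemma box_cons k (M : k.+1.-tuple R) s (t : k.-tuple R) :
  box M (cons_pair (s, t)) <->
  0 <= s <= tnth M ord0 /\ box [tuple of behead M] t.
Proof.
have tM j : tnth [tuple of behead M] j = tnth M (lift ord0 j).
  by rewrite [in RHS](tuple_eta M) tnthS.
split=> [tbox|[sM tbox] j].
  split=> [|j]; first by have := tbox ord0; rewrite tnth0.
  by have := tbox (lift ord0 j); rewrite tnthS tM.
case: (unliftP ord0 j) => [i ->|->]; last by rewrite tnth0.
by rewrite tnthS -tM.
Qed.

Lemma bounded_by_cons_pair C k (H : k.+1.-tuple R -> R) : bounded_by C H ->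
  bounded_by C (fun p : RT * k.-tuple R => H (cons_pair (p.1, p.2))).
Proof.
move=> bH; apply: bounded_by_comp bH.
rewrite (_ : (fun _ => _) = @cons_pair R k); last by apply/funext => -[].
exact: measurable_cons_pair.
Qed.

Lemma lebesgue_tuple_box_lty k (M : k.-tuple R) : (forall j, 0 <= tnth M j) ->
  (lebesgue_tuple R k (box M) < +oo)%E.
Proof. by move=> M0; rewrite lebesgue_tuple_box// ltry. Qed.

Lemma Rintegral_box_cons C k (M : k.+1.-tuple R) (H : k.+1.-tuple R -> R) :
  (forall j, 0 <= tnth M j) -> bounded_by C H ->
  \int[lebesgue_tuple R k.+1]_(t in box M) H t =
  \int[(leb \x lebesgue_tuple R k)%E]_(p in
     `[0, tnth M ord0]%classic `*` box [tuple of behead M])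
     H (cons_pair (p.1, p.2)).
Proof.
move=> M0 bH; have [mH _] := bH.
have preE : @cons_pair R k @^-1` box M =
    `[0, tnth M ord0]%classic `*` box [tuple of behead M].
  by apply/seteqP; split => -[s t] /=; rewrite in_itv/= => /box_cons.
rewrite /Rintegral -preE; congr fine.
have mcp : measurable_fun [set: RT * k.-tuple R] (@cons_pair R k).
  exact: measurable_cons_pair.
rewrite [LHS](_ : _ = (\int[pushforward (@lebesgue_measure R \x lebesgue_tuple R k)
   (@cons_pair R k)]_(t in box M) (H t)%:E)%E); last by [].
rewrite integral_pushforward//.
- exact/measurable_EFinP.
- apply: (@bounded_by_integrable _ (RT * k.-tuple R)%type R
    (leb \x lebesgue_tuple R k)%E C (H \o @cons_pair R k)).
  + rewrite -[X in measurable X]setTI; apply: mcp => //.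
    exact: measurable_box.
  + exact: (lebesgue_tuple_box_lty M0).
  + exact: (bounded_by_comp mcp bH).
- exact: measurable_box.
Qed.

(** Fubini's theorem in the coordinate j. The conclusion is a product rather
    than a quotient, because the side of the box along j may vanish. *)
Lemma box_fiber_bound C B k (M : k.-tuple R) (H : k.-tuple R -> R) (j : 'I_k) :
  (forall i, 0 <= tnth M i) -> bounded_by C H ->
  (forall t, box M t ->
    `|\int[leb]_(v in `[0, tnth M j]) H (set_coord t j v)| <= B) ->
  tnth M j * `|\int[lebesgue_tuple R k]_(t in box M) H t| <=
    B * \prod_(i < k) tnth M i.
Proof.
elim: k M H j => [M H []//|k IH M H j M0 bH HB].
pose M' := [tuple of behead M].
have tM i : tnth M' i = tnth M (lift ord0 i).
  by rewrite [in RHS](tuple_eta M) tnthS.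
have M'0 i : 0 <= tnth M' i by rewrite tM.
have mb := measurable_box M'.
have boo := lebesgue_tuple_box_lty M'0.
have mi : measurable (`[0, tnth M ord0]%classic : set RT).
  exact: measurable_itv.
have ioo : (leb `[0%R, tnth M ord0] < +oo)%E by exact: lebesgue_itv_lty.
have bH' := bounded_by_cons_pair bH.
rewrite (Rintegral_box_cons M0 bH) big_ord_recl.
case: (unliftP ord0 j) HB => [i ->|->] HB.
  rewrite -(@Rintegral_fubini1 _ _ _ _ _ leb (lebesgue_tuple R k) _ _ mi mb ioo boo
    C (fun s t => H (cons_pair (s, t))))//.
  have bint := @bounded_by_Rintegral _ _ _ _ _ (lebesgue_tuple R k) _ mb boo
    C (fun s t => H (cons_pair (s, t))) bH'.
  rewrite -[X in X * `|_|]ger0_norm// -normrM -RintegralZl//; last first.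
    exact: (itv_integrable bint ioo).
  rewrite mulrCA -[X in X * (B * _)]subr0 mulrC.
  apply: (le_norm_itv_in (M0 _) (bounded_byM (bounded_by_cst _ _) bint)) => s sM.
  rewrite normrM ger0_norm// -tM.
  under eq_bigr do rewrite -tM.
  apply: (IH M' (fun t => H (cons_pair (s, t)))) => //.
    exact: (@bounded_by_pair1 _ _ _ _ _ C (fun s t => H (cons_pair (s, t))) s bH').
  move=> t tM'; have /HB : box M (cons_pair (s, t)) by apply/box_cons.
  by rewrite tM; under eq_Rintegral do rewrite set_coord_lift.
rewrite -(@Rintegral_fubini2 _ _ _ _ _ leb (lebesgue_tuple R k) _ _ mi mb ioo boo
    C (fun s t => H (cons_pair (s, t))))//.
rewrite mulrCA ler_wpM2l//.
have -> : \prod_(i < k) tnth M (lift ord0 i) = fine (lebesgue_tuple R k (box M')).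
  by rewrite lebesgue_tuple_box//=; apply: eq_bigr => i _; rewrite tM.
have bint : bounded_by (C * fine (leb `[0%R, tnth M ord0]))
    (fun t => \int[leb]_(s in `[0, tnth M ord0]) H (cons_pair (s, t))).
  apply: (@bounded_by_Rintegral _ _ _ _ _ leb _ mi ioo
    C (fun t s => H (cons_pair (s, t)))).
  apply: (bounded_by_comp (u := fun p : k.-tuple R * RT => (p.2, p.1))) bH'.
  exact: measurable_swap.
apply: (le_norm_Rintegral_in mb boo bint) => t tM'.
have /HB : box M (cons_pair (0, t)) by apply/box_cons; rewrite lexx M0.
by under eq_Rintegral do rewrite set_coord0.
Qed.

End box.

(** * Upper limits and the maximal ergodic theorem *)

Section limsup.
Context (R : realType).
Implicit Types (u v : R^nat) (C e : R).

Section bounded_sequence.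
Context C u (uC : forall n, `|u n| <= C).

Let ub_u : has_ubound (range u).
Proof. by exists C => _ [n _ <-]; exact: le_trans (ler_norm _) (uC n). Qed.

Let lb_u : has_lbound (range u).
Proof. by exists (- C) => _ [n _ <-]; have := uC n; rewrite ler_norml => /andP[]. Qed.

Let ub_sdrop n : has_ubound (sdrop u n).
Proof. exact/has_ubound_sdrop. Qed.

Let cvg_sups : sups u @ \oo --> limn_sup u.
Proof. by have /cvgP := cvg_sups_inf ub_u lb_u. Qed.

Let limn_sup_le_sups n : limn_sup u <= sups u n.
Proof.
apply: nonincreasing_cvgn_ge; first exact: nonincreasing_sups.
by apply/cvg_ex; eexists; exact: cvg_sups.
Qed.

Lemma limn_sup_lt e : 0 < e ->
  exists N, forall n, (N <= n)%N -> u n < limn_sup u + e.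
Proof.
move=> e0; have /cvgrPdist_lt /(_ e e0) [N _ HN] := cvg_sups.
exists N => n Nn; have := HN N (leqnn N).
rewrite ltr_norml => /andP[+ _]; rewrite ltrNl opprB ltrBlDl => suN.
apply: le_lt_trans suN; apply: ub_le_sup; first exact: ub_sdrop.
by exists n.
Qed.

Lemma limn_sup_gt e N : 0 < e ->
  exists2 n, (N <= n)%N & limn_sup u - e < u n.
Proof.
move=> e0; have : limn_sup u - e < sups u N.
  by apply: lt_le_trans (limn_sup_le_sups N); rewrite ltrBlDr ltrDl.
by case/sup_gt => [|_ [n Nn <-]]; [exists (u N); exists N => //=|exists n].
Qed.

Lemma normr_limn_sup : `|limn_sup u| <= C.
Proof.
rewrite ler_norml; apply/andP; split; apply/ler_addgt0Pr => e e0.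
- have [N Nu] := limn_sup_lt e0.
  apply: le_trans (ltW (Nu N (leqnn N))).
  by have := uC N; rewrite ler_norml => /andP[].
- have [n _] := limn_sup_gt 0 e0; rewrite ltrBlDr => /ltW /le_trans; apply.
  by rewrite lerD2r; exact: le_trans (ler_norm _) (uC n).
Qed.

End bounded_sequence.

Lemma eq_limn_sup C C' u v : (forall n, `|u n| <= C) -> (forall n, `|v n| <= C') ->
  u n - v n @[n --> \oo] --> 0 -> limn_sup u = limn_sup v.
Proof.
suff le C1 C2 (a b : R^nat) :
    (forall n, `|a n| <= C1) -> (forall n, `|b n| <= C2) ->
    a n - b n @[n --> \oo] --> 0 -> limn_sup a <= limn_sup b.
  move=> uC vC uv; apply/le_anti/andP; split; first exact: (le C C').
  apply: (le C' C) => //; rewrite -oppr0.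
  by under eq_fun do rewrite -opprB; exact: cvgN.
move=> aC bC ab; apply/ler_addgt0Pr => e e0.
have e3 : 0 < e / 3 by rewrite divr_gt0.
have /cvgrPdist_lt /(_ _ e3) [N _ HN] := ab.
have [N' bN'] := limn_sup_lt bC e3.
have [n Nn an] := limn_sup_gt aC (maxn N N') e3.
have := HN n (leq_trans (leq_maxl _ _) Nn).
have := bN' n (leq_trans (leq_maxr _ _) Nn).
rewrite sub0r normrN ltr_norml => bn /andP[_ abn].
by lra.
Qed.

Lemma limn_supN_ge C u : (forall n, `|u n| <= C) ->
  0 <= limn_sup u + limn_sup (fun n => - u n).
Proof.
move=> uC; have uC' n : `|- u n| <= C by rewrite normrN.
apply/ler_addgt0Pr => e e0.
have e2 : 0 < e / 2 by rewrite divr_gt0.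
have [N uN] := limn_sup_lt uC e2.
have [N' uN'] := limn_sup_lt uC' e2.
have := uN _ (leq_maxl N N'); have := uN' _ (leq_maxr N N').
by lra.
Qed.

Lemma cvg_limn_sup C u : (forall n, `|u n| <= C) ->
  limn_sup u + limn_sup (fun n => - u n) = 0 -> u @ \oo --> limn_sup u.
Proof.
move=> uC u0; have uC' n : `|- u n| <= C by rewrite normrN.
apply/cvgrPdist_lt => e e0.
have [N uN] := limn_sup_lt uC e0.
have [N' uN'] := limn_sup_lt uC' e0.
exists (maxn N N') => // n /= Nn.
have := uN n (leq_trans (leq_maxl _ _) Nn).
have := uN' n (leq_trans (leq_maxr _ _) Nn).
move: u0; set a := limn_sup _; set b := limn_sup _ => u0 h1 h2.
by rewrite ltr_norml; apply/andP; split; lra.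
Qed.

End limsup.

Section probability_bounded.
Context d (X : measurableType d) (R : realType) (mu : probability X R).
Implicit Types (f : X -> R) (C : R).

Lemma probability_lty (D : set X) : measurable D -> (mu D < +oo)%E.
Proof. by move=> mD; rewrite (le_lt_trans (probability_le1 mu mD))// ltry. Qed.

Lemma probability_nonempty : [set: X] !=set0.
Proof.
apply/set0P; apply/eqP => X0; have := probability_setT mu.
by rewrite X0 measure0 => /esym/eqP; rewrite onee_eq0.
Qed.

Lemma probability_bounded_integrable C f D : measurable D -> bounded_by C f ->
  mu.-integrable D (EFin \o f).
Proof. by move=> mD; apply: bounded_by_integrable => //; exact: probability_lty. Qed.

Lemma bounded_convergence C (f_ : nat -> X -> R) f D : measurable D ->
  (forall n, bounded_by C (f_ n)) -> bounded_by C f ->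
  {ae mu, forall x, f_ n x @[n --> \oo] --> f x} ->
  \int[mu]_(x in D) f_ n x @[n --> \oo] --> \int[mu]_(x in D) f x.
Proof.
move=> mD bf_ bf f_f.
have [|||||_ _ h] := @dominated_convergence _ X R mu D mD
  (fun n => EFin \o f_ n) (EFin \o f) (cst C%:E).
- by move=> n; apply: (measurable_int mu); exact: probability_bounded_integrable (bf_ n).
- by apply: (measurable_int mu); exact: probability_bounded_integrable bf.
- by apply: filterS f_f => x f_f _; apply: cvg_EFin; [exact: nearW|exact: f_f].
- exact: (probability_bounded_integrable mD (bounded_by_cst _ C)).
- by apply: nearW => x n _; rewrite lee_fin; exact: (bf_ n).2.
apply: fine_cvg; rewrite fineK; first exact: h.
by apply: integrable_fin_num => //; exact: probability_bounded_integrable bf.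
Qed.

Lemma ae_eq0_of_Rintegral C f : bounded_by C f -> (forall x, 0 <= f x) ->
  \int[mu]_x f x <= 0 -> {ae mu, forall x, f x = 0}.
Proof.
move=> bf f0 If.
have intf := probability_bounded_integrable measurableT bf.
have If0 : (\int[mu]_x `|(EFin \o f) x| = 0)%E.
  transitivity (\int[mu]_x (f x)%:E)%E.
    by apply: eq_integral => x _ /=; rewrite ger0_norm.
  rewrite -[LHS]fineK; last exact: integrable_fin_num.
  congr EFin; apply/le_anti; rewrite If/=.
  by apply: fine_ge0; apply: integral_ge0 => x _; rewrite lee_fin.
have /(ae_eq_integral_abs mu measurableT) := If0.
move=> /(_ (measurable_int _ intf)).
by apply: filterS => x /(_ I) /= [].
Qed.

End probability_bounded.

Section maximal_ergodic.
Context d (X : measurableType d) (R : realType) (mu : probability X R).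
Context (tau : X -> X) (psi : X -> R) (C : R).
Context (mtau : measurable_fun setT tau) (bpsi : bounded_by C psi).
Context (tau_inv : forall C' f, bounded_by C' f ->
  \int[mu]_x f (tau x) = \int[mu]_x f x).

(** The maximum of 0 and the Birkhoff sums of psi of length at most n. *)
Fixpoint max_birkhoff_sum n (x : X) : R :=
  if n is n'.+1 then Num.max 0 (psi x + max_birkhoff_sum n' (tau x)) else 0.

Let M := max_birkhoff_sum.

Lemma max_birkhoff_sum_ge0 n x : 0 <= M n x.
Proof. by case: n => //= n; rewrite le_max lexx. Qed.

Let bounded_max n : exists C', bounded_by C' (M n).
Proof.
elim: n => [|n [C' bM]]; first by exists `|0 : R|; exact: bounded_by_cst.
exists (C + C').
have [m1 b1] := bounded_byD bpsi (bounded_by_comp mtau bM).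
split=> [|x /=]; first exact: measurable_maxr.
rewrite /Num.max; case: ifP => _; first exact: b1.
by rewrite normr0; exact: bounded_by_ge0 x (conj m1 b1).
Qed.

Let max_nd n x : M n x <= M n.+1 x.
Proof.
elim: n x => [|n IH] x; first exact: max_birkhoff_sum_ge0.
rewrite /M /= -/(max_birkhoff_sum n.+1 (tau x)).
rewrite ge_max le_max lexx/= le_max; apply/orP; right.
by rewrite lerD2l; exact: IH.
Qed.

Let pos n : set X := [set x | 0 < M n x].

Let mpos n : measurable (pos n).
Proof.
have [C' [mM _]] := bounded_max n.
rewrite (_ : pos n = M n @^-1` `]0, +oo[%classic).
  by rewrite -[X in measurable X]setTI; apply: mM => //; exact: measurable_itv.
by apply/seteqP; split => x; rewrite /pos/= in_itv/= andbT.
Qed.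

Let bounded_indic_pos n : bounded_by 1 (\1_(pos n) : X -> R).
Proof.
split=> [|x]; first exact: measurable_indic.
by rewrite indicE; case: (_ \in _); rewrite ?normr1 ?normr0.
Qed.

(** Garsia's argument. With M n for max_birkhoff_sum n: where M n.+1 is positive,
    it equals psi + M n o tau, so psi >= M n.+1 - M n.+1 o tau; elsewhere this
    difference is at most 0. Its integral vanishes because tau preserves the
    measure, so psi has nonnegative integral over the set where M n.+1 is
    positive, and these sets increase to the whole space. *)
Lemma maximal_ergodic : (forall x, exists n, 0 < M n x) ->
  0 <= \int[mu]_x psi x.
Proof.
move=> Mpos.
have step n : 0 <= \int[mu]_x (\1_(pos n.+1) x * psi x).
  have [C' bM] := bounded_max n.+1.
  have bMtau := bounded_by_comp mtau bM.
  have -> : 0 = \int[mu]_x (M n.+1 x - M n.+1 (tau x)).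
    rewrite RintegralB ?(tau_inv bM) ?subrr//.
      exact: probability_bounded_integrable bM.
    exact: probability_bounded_integrable bMtau.
  apply: le_Rintegral => //.
  - exact: probability_bounded_integrable (bounded_byB bM bMtau).
  - exact: probability_bounded_integrable (bounded_byM (bounded_indic_pos _) bpsi).
  move=> x _; rewrite indicE; have [xp|xp] := boolP (x \in _).
    rewrite mul1r lerBlDr.
    have : 0 < M n.+1 x by move: xp; rewrite inE.
    rewrite {1 2}/M /= lt_max ltxx/= => p0.
    by rewrite max_r ?(ltW p0)// lerD2l; exact: max_nd.
  rewrite mul0r subr_le0.
  move: xp; rewrite notin_setE => /negP; rewrite -leNgt => /le_trans; apply.
  exact: (max_birkhoff_sum_ge0 n.+1).
have lim : \int[mu]_x (\1_(pos n) x * psi x) @[n --> \oo] --> \int[mu]_x psi x.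
  apply: (@bounded_convergence _ _ _ _ C) => //.
    move=> n; rewrite -[C]mul1r; exact: (bounded_byM (bounded_indic_pos n) bpsi).
  apply: nearW => x; have [n Mn] := Mpos x.
  apply: cvg_near_cst; exists n => // m /= nm.
  rewrite indicE mem_set ?mul1r// /pos/=; apply: lt_le_trans Mn _.
  exact: (homo_leq (@lexx _ _) (@le_trans _ _) (max_nd ^~ x)).
rewrite -(cvg_lim _ lim)//; apply: limr_ge; first by apply/cvg_ex; eexists; exact: lim.
apply: nearW => -[|n]; last exact: step.
by apply: Rintegral_ge0 => x _; rewrite indicE memNset ?mul0r// /pos/= ltxx.
Qed.

End maximal_ergodic.

(** * The ergodic theorem for measurable flows *)

Section mean_value.
Context (R : realType).
Notation leb := (@lebesgue_measure R).

(** The means of F over [0, N] tend to b. The error eta N + K is meaningful for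
    short intervals as well, which arise when [r, N + r] is written as a
    difference of intervals starting at 0. *)
Definition mean_value (F : R -> R) (b : R) := forall eta : R, 0 < eta ->
  exists K : R, forall N : R, 0 <= N ->
    `|\int[leb]_(t in `[0, N]) F t - b * N| <= eta * N + K.

Lemma mean_value_of_cvg C (F : R -> R) (b : R) : bounded_by C F ->
  n.+1%:R^-1 * (\int[leb]_(t in `[0, n.+1%:R]) F t) @[n --> \oo] --> b ->
  mean_value F b.
Proof.
move=> bF Fb eta eta0.
have C0 : 0 <= C := bounded_by_ge0 (0 : R) bF.
have Cb0 : 0 <= C + `|b| by rewrite addr_ge0.
have /cvgrPdist_lt /(_ _ eta0) [N0 _ HN0] := Fb.
exists ((C + `|b|) * N0.+2%:R) => N N_ge0.
have crude m : 0 <= m -> m <= N ->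
    `|\int[leb]_(t in `[m, N]) F t - b * (N - m)| <= (C + `|b|) * (N - m).
  move=> m0 mN; apply: le_trans (ler_normB _ _) _.
  rewrite mulrDl lerD//; first exact: le_norm_itv bF.
  by rewrite normrM [`|N - m|]ger0_norm ?subr_ge0.
have [mN Nm] : (Num.truncn N)%:R <= N /\ N < (Num.truncn N).+1%:R.
  by have /andP[] := truncn_itv N_ge0.
set m := Num.truncn N in mN Nm.
have [N0m|mN0] := leqP N0.+1 m; last first.
  have := crude 0 (lexx _) N_ge0; rewrite !subr0 => /le_trans; apply.
  apply: (@le_trans _ _ ((C + `|b|) * N0.+2%:R)).
    by rewrite ler_wpM2l// (le_trans (ltW Nm))// ler_nat leqW.
  by rewrite lerDr mulr_ge0// ltW.
case: m => [//|m] in mN Nm N0m *.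
have := HN0 m N0m; rewrite distrC => Hm.
have -> : \int[leb]_(t in `[0, N]) F t - b * N =
   m.+1%:R * (m.+1%:R^-1 * \int[leb]_(t in `[0, m.+1%:R]) F t - b) +
   (\int[leb]_(t in `[m.+1%:R, N]) F t - b * (N - m.+1%:R)).
  rewrite (@Rintegral_itvD _ C F 0 m.+1%:R N)//.
  have m0 : m.+1%:R != 0 :> R by rewrite pnatr_eq0.
  by set q := m.+1%:R in m0 *; field.
apply: le_trans (ler_normD _ _) _; apply: lerD.
  rewrite normrM normr_nat mulrC; apply: ler_pM => //; exact: ltW.
apply: le_trans (crude _ _ _) _ => //; rewrite ler_wpM2l//.
have -> : N0.+2%:R = N0.+1%:R + 1 :> R by rewrite -natr1.
have : N < m.+1%:R + 1 by rewrite natr1.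
have : 0 <= N0.+1%:R :> R by [].
by lra.
Qed.

End mean_value.

Section flow.
Context (R : realType) d (X : measurableType d) (mu : probability X R).
Context (T : R -> X -> X) (hT : measurable_flow mu T).
Notation leb := (@lebesgue_measure R).
Notation RT := (measurableTypeR R).
Implicit Types (f : X -> R) (C : R).

Lemma flowD s t x : T (s + t) x = T s (T t x).
Proof. by case: hT => _ -> _ _. Qed.

Lemma flow0 x : T 0 x = x.
Proof. by case: hT => -> _ _ _. Qed.

Lemma flowK t x : T (- t) (T t x) = x.
Proof. by rewrite -flowD addNr flow0. Qed.

Lemma flowNK t x : T t (T (- t) x) = x.
Proof. by rewrite -flowD subrr flow0. Qed.

Lemma measurable_flow_map t : measurable_fun setT (T t).
Proof. by case: hT => _ _ /(_ t) []. Qed.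

Lemma bounded_by_flow C f t : bounded_by C f -> bounded_by C (fun x => f (T t x)).
Proof. by apply: bounded_by_comp; exact: measurable_flow_map. Qed.

Lemma bounded_by_orbit2 C f : bounded_by C f ->
  bounded_by C (fun p : RT * X => f (T p.1 p.2)).
Proof. by apply: bounded_by_comp; case: hT. Qed.

Lemma bounded_by_orbit2_swap C f : bounded_by C f ->
  bounded_by C (fun p : X * RT => f (T p.2 p.1)).
Proof.
move=> /bounded_by_orbit2; apply: (bounded_by_comp (u := fun p => (p.2, p.1))).
exact: measurable_swap.
Qed.

Lemma bounded_by_orbit C f x : bounded_by C f ->
  bounded_by C (fun t : R => f (T t x)).
Proof.
move=> bf; exact: (@bounded_by_pair2 _ _ _ _ _ C (fun t x => f (T t x)) x
  (bounded_by_orbit2 bf)).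
Qed.

Lemma flow_expectation C f t : bounded_by C f ->
  \int[mu]_x f (T t x) = \int[mu]_x f x.
Proof.
move=> bf; have mT := measurable_flow_map t; have [mf _] := bf.
rewrite /Rintegral; congr fine.
transitivity (\int[pushforward mu (T t)]_x (f x)%:E)%E.
  rewrite integral_pushforward//.
  - exact/measurable_EFinP.
  - rewrite preimage_setT.
    exact: probability_bounded_integrable (bounded_by_flow t bf).
apply: eq_measure_integral => A mA _.
by case: hT => _ _ /(_ t) [_] /(_ A mA).
Qed.

Definition orbit_integral f (N : R) x := \int[leb]_(s in `[0, N]) f (T s x).

Lemma bounded_by_orbit_integral C f N : 0 <= N -> bounded_by C f ->
  bounded_by (C * N) (orbit_integral f N).
Proof.
move=> N0 bf; rewrite -[N in C * N]subr0 -fine_lebesgue_itv//.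
apply: (@bounded_by_Rintegral _ _ X RT R leb `[0, N]%classic
  (measurable_itv _) (lebesgue_itv_lty _ _) C (fun x s => f (T s x))) => //.
exact: bounded_by_orbit2_swap.
Qed.

Lemma orbit_integral_flow C f N t x : bounded_by C f ->
  orbit_integral f N (T t x) = \int[leb]_(s in `[t, N + t]) f (T s x).
Proof.
move=> bf; have := Rintegral_translation 0 N t (bounded_by_orbit x bf).
rewrite add0r => <-; apply: eq_Rintegral => s _; by rewrite flowD.
Qed.

Lemma expectation_orbit_integral C f N (A : set X) : 0 <= N -> measurable A ->
  bounded_by C f ->
  \int[mu]_(x in A) orbit_integral f N x =
  \int[leb]_(s in `[0, N]) \int[mu]_(x in A) f (T s x).
Proof.
move=> N0 mA bf.
apply: (@Rintegral_swap _ _ X RT R mu leb A `[0, N]%classic mA (measurable_itv _)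
   (probability_lty mu mA) (lebesgue_itv_lty _ _) C (fun x s => f (T s x))) => //.
exact: bounded_by_orbit2_swap.
Qed.

Definition orbit_average f n x := n.+1%:R^-1 * orbit_integral f n.+1%:R x.

(** An upper limit along the integers is defined at every point, measurable and
    exactly invariant, which makes it a version of the conditional expectation
    once the averages are known to converge. *)
Definition orbit_mean f x := limn_sup (fun n => orbit_average f n x).

Lemma bounded_by_orbit_average C f n : bounded_by C f ->
  bounded_by C (orbit_average f n).
Proof.
move=> bf; have -> : C = `|n.+1%:R^-1| * (C * n.+1%:R).
  by rewrite ger0_norm// mulrCA mulVf ?mulr1// pnatr_eq0.
exact: (bounded_byM (bounded_by_cst _ _) (bounded_by_orbit_integral _ bf)).
Qed.

Lemma bounded_by_orbit_mean C f : bounded_by C f -> bounded_by C (orbit_mean f).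
Proof.
move=> bf; have ba n := bounded_by_orbit_average n bf.
split=> [|x]; last by apply: normr_limn_sup => n; exact: (ba n).2.
apply: (measurable_fun_limn_sup (h := orbit_average f)) => [x _|x _|n].
- by exists C => _ [n _ <-]; exact: le_trans (ler_norm _) ((ba n).2 x).
- by exists (- C) => _ [n _ <-]; have := (ba n).2 x; rewrite ler_norml => /andP[].
- exact: (ba n).1.
Qed.

(** Orbit segments of length n starting at y and at T s y differ by two pieces of
    length s, which disappear in the average. *)
Lemma orbit_mean_flow C f t x : bounded_by C f ->
  orbit_mean f (T t x) = orbit_mean f x.
Proof.
move=> bf.
suff H s y : 0 <= s -> orbit_mean f (T s y) = orbit_mean f y.
  have [t0|t0] := leP 0 t; first exact: H.
  by rewrite -[in RHS](flowK t x) (H (- t))// oppr_ge0 ltW.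
move=> s0; have ba n := bounded_by_orbit_average n bf.
have C0 : 0 <= C := bounded_by_ge0 y bf.
apply: (@eq_limn_sup _ C C) => [n|n|]; try exact: (ba n).2.
apply: norm_cvg0.
apply: (@squeeze_cvgr _ _ _ _ (cst 0) (fun n => harmonic n * (C * s + C * s))).
- apply: nearW => n; rewrite normr_ge0/= /orbit_average -mulrBr normrM.
  rewrite ger0_norm// ler_wpM2l//.
  rewrite (orbit_integral_flow _ _ _ bf) /orbit_integral.
  have bo := bounded_by_orbit y bf.
  have [le1 le2] : 0 <= n.+1%:R :> R /\ s <= n.+1%:R + s by rewrite lerDr.
  have := Rintegral_itvD bo s0 le2.
  have le3 : n.+1%:R <= n.+1%:R + s by rewrite lerDl.
  rewrite (Rintegral_itvD bo le1 le3) => E.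
  have -> : \int[leb]_(s0 in `[s, n.+1%:R + s]) f (T s0 y) -
      \int[leb]_(s0 in `[0, n.+1%:R]) f (T s0 y) =
      \int[leb]_(x in `[n.+1%:R, (n.+1%:R + s)]) f (T x y) -
      \int[leb]_(x in `[0, s]) f (T x y).
    by move: E; lra.
  apply: le_trans (ler_normB _ _) _; apply: lerD.
    by apply: le_trans (le_norm_itv le3 bo) _; rewrite addrAC subrr add0r.
  by apply: le_trans (le_norm_itv s0 bo) _; rewrite subr0.
- exact: cvg_cst.
- by rewrite -[X in _ --> X](mul0r (C * s + C * s)); apply: cvgMl; exact: cvg_harmonic.
Qed.

Lemma orbit_integralN C f N x : bounded_by C f ->
  orbit_integral (fun x => - f x) N x = - orbit_integral f N x.
Proof.
move=> bf; rewrite /orbit_integral -[RHS]mulN1r.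
rewrite -(RintegralZ_itv _ _ _ (bounded_by_orbit x bf)).
by apply: eq_Rintegral => s _; rewrite mulN1r.
Qed.

Lemma orbit_meanN C f x : bounded_by C f ->
  orbit_mean (fun x => - f x) x = limn_sup (fun n => - orbit_average f n x).
Proof.
move=> bf; congr limn_sup; apply/funext => n.
by rewrite /orbit_average (orbit_integralN _ _ bf) mulrN.
Qed.

(** The maximal ergodic theorem is applied to the time one map and to the
    integral of f over the first unit of time, minus the invariant function
    orbit_mean f, plus e. The Birkhoff sum of length n of this function is n
    times (average - upper limit + e), so at every point one of them is
    positive. *)
Lemma expectation_orbit_mean_le C f : bounded_by C f ->
  \int[mu]_x orbit_mean f x <= \int[mu]_x f x.
Proof.
move=> bf; apply/ler_addgt0Pr => e e0.
have bom := bounded_by_orbit_mean bf.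
have boi := bounded_by_orbit_integral ler01 bf.
pose psi x := orbit_integral f 1 x - orbit_mean f x + e.
have bpsi := bounded_byD (bounded_byB boi bom) (bounded_by_cst X e).
have MS n x : orbit_integral f n%:R x - n%:R * orbit_mean f x + n%:R * e <=
    max_birkhoff_sum (T 1) psi n x.
  elim: n x => [|n IH] x.
    by rewrite /orbit_integral set_itv1 Rintegral_set1 !mul0r subrr addr0.
  rewrite /= le_max; apply/orP; right.
  have := IH (T 1 x); rewrite (orbit_mean_flow _ _ bf) /psi.
  have -> : orbit_integral f n.+1%:R x =
      orbit_integral f 1 x + orbit_integral f n%:R (T 1 x).
    rewrite (orbit_integral_flow _ _ _ bf) natr1.
    by rewrite -(Rintegral_itvD (bounded_by_orbit x bf))// ler1n.
  by rewrite -natr1; lra.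
have : 0 <= \int[mu]_x psi x.
  apply: (maximal_ergodic (measurable_flow_map 1) bpsi).
    by move=> C' h bh; exact: flow_expectation bh.
  move=> x; have bav n : `|orbit_average f n x| <= C.
    by have [_] := bounded_by_orbit_average n bf; exact.
  have [n _] := limn_sup_gt bav 0 e0; rewrite -/(orbit_mean f x) => Hn.
  exists n.+1; apply: lt_le_trans (MS n.+1 x).
  move: Hn; rewrite /orbit_average -subr_gt0 => Hn.
  have -> : orbit_integral f n.+1%:R x - n.+1%:R * orbit_mean f x + n.+1%:R * e =
      n.+1%:R * (n.+1%:R^-1 * orbit_integral f n.+1%:R x - (orbit_mean f x - e)).
    have m0 : n.+1%:R != 0 :> R by rewrite pnatr_eq0.
    by set q := n.+1%:R in m0 *; field.
  by rewrite mulr_gt0.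
have int h C' : bounded_by C' h -> mu.-integrable setT (EFin \o h).
  exact: probability_bounded_integrable.
rewrite RintegralD//; [|exact: int (bounded_byB boi bom)|exact: int (bounded_by_cst X e)].
rewrite RintegralB//; [|exact: int boi|exact: int bom].
rewrite (expectation_orbit_integral _ _ bf)//.
under eq_Rintegral do rewrite (flow_expectation _ bf).
rewrite Rintegral_cst_itv// subr0 mulr1 Rintegral_cst//.
have -> : fine (mu setT) = 1 by rewrite probability_setT.
rewrite mulr1.
by rewrite addrAC subr_ge0.
Qed.

(** Applying expectation_orbit_mean_le to f and to - f, the upper limit minus the
    lower limit of the averages is nonnegative with integral at most 0. *)
Lemma birkhoff_ae C f : bounded_by C f ->
  {ae mu, forall x, orbit_average f n x @[n --> \oo] --> orbit_mean f x}.
Proof.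
move=> bf; have bf' := bounded_byN bf.
have bav x n : `|orbit_average f n x| <= C.
  by have [_] := bounded_by_orbit_average n bf; exact.
have bom := bounded_by_orbit_mean bf; have bom' := bounded_by_orbit_mean bf'.
have int h C' : bounded_by C' h -> mu.-integrable setT (EFin \o h).
  exact: probability_bounded_integrable.
have := ae_eq0_of_Rintegral (mu := mu) (bounded_byD bom bom').
have sum_ge0 x : 0 <= orbit_mean f x + orbit_mean (fun x => - f x) x.
  by rewrite (orbit_meanN _ bf); exact: limn_supN_ge (bav x).
have sum_le0 : \int[mu]_x (orbit_mean f x + orbit_mean (fun x => - f x) x) <= 0.
  rewrite RintegralD//; [|exact: int bom|exact: int bom'].
  rewrite -(subrr (\int[mu]_x f x)); apply: lerD.
    exact: expectation_orbit_mean_le bf.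
  apply: le_trans (expectation_orbit_mean_le bf') _.
  rewrite -mulN1r -RintegralZl//; last exact: int bf.
  by under eq_Rintegral do rewrite -mulN1r.
move=> /(_ sum_ge0 sum_le0); apply: filterS => x.
by rewrite (orbit_meanN _ bf); exact: cvg_limn_sup (bav x).
Qed.

Theorem birkhoff C f : bounded_by C f ->
  {ae mu, forall x, mean_value (fun t => f (T t x)) (orbit_mean f x)}.
Proof.
move=> bf; apply: filterS (birkhoff_ae bf) => x.
exact: mean_value_of_cvg (bounded_by_orbit x bf).
Qed.

(** The indicator of A is almost everywhere invariant, so it can be composed with
    T t, which preserves the measure. *)
Lemma invariant_sets_expectation C f t (A : set X) : invariant_sets mu T A ->
  bounded_by C f -> \int[mu]_(x in A) f (T t x) = \int[mu]_(x in A) f x.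
Proof.
move=> [mA invA] bf.
have bA : bounded_by 1 (\1_A : X -> R).
  split=> [|x]; first exact: measurable_indic.
  by rewrite indicE; case: (_ \in _); rewrite ?normr1 ?normr0.
have restrict (h : X -> R) : \int[mu]_(x in A) h x = \int[mu]_x (\1_A x * h x).
  rewrite Rintegral_mkcond; apply: eq_Rintegral => x _.
  by rewrite patchE indicE; case: ifP; rewrite ?mul1r ?mul0r.
rewrite !restrict -[RHS](flow_expectation t (bounded_byM bA bf)).
congr fine; apply: ae_eq_integral => //.
- apply: (measurable_int mu); apply: probability_bounded_integrable => //.
  exact: (bounded_byM bA (bounded_by_flow t bf)).
- apply: (measurable_int mu); apply: probability_bounded_integrable => //.
  exact: (bounded_by_flow t (bounded_byM bA bf)).
apply: negligibleS (invA (- t)) => x /= xA.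
apply: contrapT => nA; apply: xA => _; congr (_ * _)%:E.
rewrite !indicE; congr (_%:R); congr nat_of_bool; apply/idP/idP => /set_mem xA.
- apply: mem_set; apply: contrapT => TxA; apply: nA; right; split=> // -[y Ay yx].
  by apply: TxA; rewrite -yx (flowNK t y).
- apply: mem_set; apply: contrapT => xA'; apply: nA; left; split=> //.
  by exists (T t x) => //; rewrite flowK.
Qed.

Lemma Rintegral_orbit_mean C f (A : set X) : invariant_sets mu T A ->
  bounded_by C f ->
  \int[mu]_(x in A) orbit_mean f x = \int[mu]_(x in A) f x.
Proof.
move=> invA bf; have [mA _] := invA.
have := bounded_convergence mA (fun n => bounded_by_orbit_average n bf)
  (bounded_by_orbit_mean bf) (birkhoff_ae bf).
move=> /(cvg_lim (@Rhausdorff R)) <-.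
apply/esym; rewrite [X in limn X](_ : _ = cst (\int[mu]_(x in A) f x)).
  by rewrite lim_cst.
apply/funext => n; rewrite /orbit_average RintegralZl//; last first.
  exact: probability_bounded_integrable (bounded_by_orbit_integral _ bf).
rewrite (expectation_orbit_integral _ _ bf)//.
under eq_Rintegral do rewrite (invariant_sets_expectation _ invA bf).
by rewrite Rintegral_cst_itv// subr0 mulrCA mulVf ?mulr1// pnatr_eq0.
Qed.

End flow.

(** * Conditional expectation given the invariant sets *)

Section conditional_expectation.
Context (R : realType) d (X : measurableType d) (mu : probability X R).
Implicit Types (F G : set (set X)) (f h : X -> R).

(** The set where h1 < h2 belongs to the sigma-algebra, so h1 and h2 have the same
    integral over it. *)
Lemma cond_exp_ae_le G f h1 h2 :
  G `<=` measurable ->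
  is_cond_exp mu (<<s G>>) f h1 -> is_cond_exp mu (<<s G>>) f h2 ->
  {ae mu, forall x, h2 x <= h1 x}.
Proof.
move=> Gm [Gh1 ih1 If1] [Gh2 ih2 If2].
pose A := [set x | h1 x < h2 x].
have GA : (<<s G>>) A.
  pose k1 : g_sigma_algebraType G -> R := h1.
  pose k2 : g_sigma_algebraType G -> R := h2.
  have mk : measurable_fun setT (fun x => k1 x - k2 x).
    by apply: measurable_funB => _ B mB; rewrite setTI; [exact: Gh1|exact: Gh2].
  have := mk measurableT `]-oo, 0[%classic (measurable_itv _).
  rewrite setTI; congr (<<s G>> _); apply/seteqP; split => x /=;
    by rewrite in_itv/= subr_lt0.
have sGm : <<s G>> `<=` measurable.
  by apply: smallest_sub => //; exact: sigma_algebra_measurable.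
have mA : measurable A by exact: sGm.
have ih1A := integrableS measurableT mA (@subsetT _ A) ih1.
have ih2A := integrableS measurableT mA (@subsetT _ A) ih2.
have I0 : (\int[mu]_(x in A) `|(EFin \o (h2 \- h1)%R) x| = 0)%E.
  transitivity (\int[mu]_(x in A) ((h2 x)%:E - (h1 x)%:E))%E.
    by apply: eq_integral => x; rewrite inE/= => hx; rewrite gtr0_norm ?subr_gt0.
  rewrite integralB//= If2// If1// subee// -If1//.
  exact: integrable_fin_num.
have /(ae_eq_integral_abs mu mA) := I0.
have mD : measurable_fun A (EFin \o (h2 \- h1)%R).
  by apply: (measurable_int mu); exact: (integrableB mA ih2A ih1A).
move=> /(_ mD); apply: filterS => x hx.
rewrite leNgt; apply/negP => h12; have /= [] := hx h12.
by move/eqP; rewrite subr_eq0 gt_eqF.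
Qed.

Lemma cond_exp_unique G f h : G `<=` measurable ->
  is_cond_exp mu (<<s G>>) f h ->
  {ae mu, forall x, cond_exp mu (<<s G>>) f x = h x}.
Proof.
move=> Gm hf.
have cf : is_cond_exp mu (<<s G>>) f (cond_exp mu (<<s G>>) f).
  by apply: (@xgetPex _ (cst 0) [set h | is_cond_exp mu (<<s G>>) f h]); exists h.
apply: filterS2 (cond_exp_ae_le Gm hf cf) (cond_exp_ae_le Gm cf hf) => x h1 h2.
by apply/le_anti; rewrite h1 h2.
Qed.

Context (T : R -> X -> X) (hT : measurable_flow mu T).

Let imageE t (A : set X) x : (T t @` A) x <-> A (T (- t) x).
Proof.
split=> [[y Ay <-]|Ax]; first by rewrite (flowK hT).
by exists (T (- t) x); rewrite // (flowNK hT).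
Qed.

(** Sets that are invariant up to null sets already form a sigma-algebra, because
    each T t is a bijection. *)
Lemma invariant_sigma_algebra_sub :
  invariant_sigma_algebra mu T `<=` invariant_sets mu T.
Proof.
apply: smallest_sub => //; split.
- split=> // t; rewrite image_set0 setY0; exact: negligible_set0.
- move=> A [mA invA]; rewrite setTD; split=> [|t]; first exact: measurableC.
  apply: negligibleS (invA t) => x; rewrite /setY/= => -[[/imageE Ax /contrapT A'x]|].
    by right; split=> // /imageE.
  move=> [nAx TnA]; left; split=> //; apply/imageE; apply: contrapT => Ax.
  by apply: TnA; exact/imageE.
- move=> A HA; split=> [|t].
    by apply: bigcupT_measurable => n; have [] := HA n.
  apply: (@negligibleS _ _ _ _ (\bigcup_n ((T t @` A n) `+` A n))).
    move=> x [[/imageE[n _ An] nA]|[[n _ An] nA]].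
      by exists n => //; left; split; [exact/imageE|move=> Ax; apply: nA; exists n].
    exists n => //; right; split=> // /imageE Ax; apply: nA; apply/imageE.
    by exists n.
  by apply: negligible_bigcup => n; have [_] := HA n; exact.
Qed.

Lemma is_cond_exp_orbit_mean C f f' : measurable_fun setT f ->
  {ae mu, forall x, f x = f' x} -> bounded_by C f' ->
  is_cond_exp mu (invariant_sigma_algebra mu T) f (orbit_mean T f').
Proof.
move=> mf ff' bf'; have bom := bounded_by_orbit_mean hT bf'.
split=> [B mB||A /invariant_sigma_algebra_sub invA].
- apply: sub_sigma_algebra; split=> [|t].
    by have [mom _] := bom; rewrite -[X in measurable X]setTI; exact: mom.
  rewrite (_ : _ @` _ = orbit_mean T f' @^-1` B).
    by rewrite setYK; exact: negligible_set0.
  by apply/seteqP; split => x; [move=> /imageE|move=> Bx; apply/imageE; move: Bx];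
    rewrite /preimage/= (orbit_mean_flow hT _ _ bf').
- exact: probability_bounded_integrable bom.
- have [mA _] := invA.
  transitivity (\int[mu]_(x in A) (f' x)%:E)%E; last first.
    apply: ae_eq_integral => //.
    + by apply/measurable_EFinP; apply: measurable_funTS; case: bf'.
    + by apply/measurable_EFinP; exact: measurable_funTS.
    + by apply: filterS ff' => x /= -> _.
  have ifin C' h : bounded_by C' h -> (\int[mu]_(x in A) (h x)%:E)%E \is a fin_num.
    move=> bh; apply: integrable_fin_num => //.
    exact: probability_bounded_integrable bh.
  rewrite -[LHS]fineK ?(ifin _ _ bom)// -[RHS]fineK ?(ifin _ _ bf')//.
  by congr EFin; exact: (Rintegral_orbit_mean hT invA bf').
Qed.

Lemma cond_exp_orbit_mean C f f' : measurable_fun setT f ->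
  {ae mu, forall x, f x = f' x} -> bounded_by C f' ->
  {ae mu, forall x,
    cond_exp mu (invariant_sigma_algebra mu T) f x = orbit_mean T f' x}.
Proof.
move=> mf ff' bf'; apply: cond_exp_unique; first by move=> A [].
exact: is_cond_exp_orbit_mean bf'.
Qed.

End conditional_expectation.

(** * Nonnegative functions with small orbit means *)

Section differentiation.
Context (R : realType).
Notation leb := (@lebesgue_measure R).

Lemma bounded_by_locally_integrable C (F : R -> R) : bounded_by C F ->
  locally_integrable [set: R] F.
Proof.
move=> bF; split; [by case: bF|exact: openT|].
move=> K _ cK; have mK : measurable K by exact: compact_measurable.
have : leb.-integrable K (EFin \o (fun x => `|F x|)).
  apply: (@bounded_by_integrable _ (measurableTypeR R) R leb C (fun x => `|F x|)) => //.
    exact: compact_finite_measure cK.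
  exact: bounded_by_norm bF.
by move=> /integrableP[_]; under eq_integral do rewrite /= normr_id.
Qed.

(** Lebesgue's differentiation theorem for the antiderivative of F, along the
    increments 1 / (n + 1). *)
Lemma right_average_cvg C (F : R -> R) : bounded_by C F ->
  {ae leb, forall s, 0 <= s ->
    n.+1%:R * \int[leb]_(t in `[s, n.+1%:R^-1 + s]) F t @[n --> \oo] --> F s}.
Proof.
move=> bF.
have Fint y : leb.-integrable [set` Interval (BLeft (-1)) (BRight y)] (EFin \o F).
  by apply: itv_integrable bF _; exact: lebesgue_itv_lty.
have := FTC1 Fint (bounded_by_locally_integrable bF).
apply: filterS; first exact: (ae_filter_ringOfSetsType leb).
move=> s /= FTCs s0.
have [|dG GF] := FTCs; first by rewrite lte_fin (lt_le_trans _ s0)// ltrN10.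
rewrite -GF derive1E.
have harm : (@harmonic R) @ \oo --> (0 : R)^'.
  move=> A A0; suff: \forall n \near \oo, A (@harmonic R n) by [].
  have : \forall n \near \oo, (@harmonic R n != 0 -> A (@harmonic R n)).
    exact: cvg_harmonic A0.
  apply: filterS => n; apply.
  by apply/negbT/gt_eqF; exact: harmonic_gt0.
have := cvg_comp _ _ harm dG; apply: cvg_trans; apply: near_eq_cvg.
apply: nearW => n /=.
set h : R := n.+1%:R^-1; have h0 : 0 < h by rewrite invr_gt0.
have -> : n.+1%:R = h^-1 by rewrite invrK.
rewrite /GRing.scale/= mulr1; congr (_ * _).
have s1 : -1 <= s by rewrite (le_trans _ s0)// lerN10.
have sh : s <= h + s by rewrite lerDr ltW.
by rewrite (Rintegral_itvD bF s1 sh) addrAC subrr add0r.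
Qed.

End differentiation.

Section small_means.
Context (R : realType) d (X : measurableType d) (mu : probability X R).
Context (T : R -> X -> X) (hT : measurable_flow mu T).
Notation leb := (@lebesgue_measure R).
Notation RT := (measurableTypeR R).
Implicit Types (f : X -> R) (C : R).

Lemma orbit_mean_ge0 C f x : bounded_by C f -> (forall y, 0 <= f y) ->
  0 <= orbit_mean T f x.
Proof.
move=> bf f0; apply/ler_addgt0Pr => e e0.
have bav n : `|orbit_average T f n x| <= C.
  by have [_] := bounded_by_orbit_average hT n bf; exact.
have [N] := limn_sup_lt bav e0 => /(_ _ (leqnn N)) /ltW; apply: le_trans.
by rewrite mulr_ge0//; exact: Rintegral_ge0.
Qed.

(** If the orbit means of all the f_n exceed 1 / (k + 1) on a set B, then
    mu B / (k + 1) is at most the integral of each f_n, hence it is 0. *)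
Lemma small_mean C (f_ : nat -> X -> R) :
  (forall n, bounded_by C (f_ n)) -> (forall n x, 0 <= f_ n x) ->
  \int[mu]_x f_ n x @[n --> \oo] --> 0 ->
  {ae mu, forall x, forall e, 0 < e -> exists n b,
    b <= e /\ mean_value (fun t => f_ n (T t x)) b}.
Proof.
move=> bf f0 If.
have om n := bounded_by_orbit_mean hT (bf n).
have small : {ae mu, forall x, forall k, exists n, orbit_mean T (f_ n) x <= k.+1%:R^-1}.
  apply: ae_foralln => k.
  pose B := \bigcap_n (orbit_mean T (f_ n) @^-1` `]k.+1%:R^-1, +oo[%classic).
  have mB : measurable B.
    apply: bigcap_measurable => // n _; rewrite -[X in measurable X]setTI.
    by apply: (om n).1 => //; exact: measurable_itv.
  pose h x := k.+1%:R^-1 * \1_B x : R.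
  have bh : bounded_by (`|k.+1%:R^-1| * 1) h.
    apply: bounded_byM; first exact: bounded_by_cst.
    split=> [|x]; first exact: measurable_indic.
    by rewrite indicE; case: (_ \in _); rewrite ?normr1 ?normr0.
  have h0 x : 0 <= h x by rewrite mulr_ge0.
  have Ih : \int[mu]_x h x <= 0.
    rewrite -(cvg_lim _ If)//; apply: limr_ge; first by apply/cvg_ex; eexists; exact: If.
    apply: nearW => n; apply: le_trans _ (expectation_orbit_mean_le hT (bf n)).
    apply: le_Rintegral => //.
    - exact: probability_bounded_integrable bh.
    - exact: probability_bounded_integrable (om n).
    move=> x _; rewrite /h indicE; have [|xB] := boolP (x \in B).
      by rewrite inE => /(_ n I); rewrite /= in_itv/= andbT mulr1 => /ltW.
    by rewrite mulr0; exact: orbit_mean_ge0 (bf n) (f0 n).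
  apply: filterS (ae_eq0_of_Rintegral bh h0 Ih) => x hx.
  apply: contrapT => /forallNP nB.
  have xB : B x.
    move=> n _; rewrite /= in_itv/= andbT ltNge; apply/negP; exact: nB.
  move: hx; rewrite /h indicE mem_set// mulr1 => /eqP.
  by rewrite invr_eq0 pnatr_eq0.
have birk : {ae mu, forall x, forall n,
    mean_value (fun t => f_ n (T t x)) (orbit_mean T (f_ n) x)}.
  by apply: ae_foralln => n; exact: birkhoff (bf n).
apply: filterS2 small birk => x small birk e e0.
have [n fn] := small (Num.truncn e^-1).
exists n, (orbit_mean T (f_ n) x); split; last exact: birk.
apply: le_trans fn _; rewrite invf_ple ?posrE//.
by rewrite ltW// truncnS_gt.
Qed.

Lemma ergodic_deviation C f : bounded_by C f ->
  \int[mu]_x `|orbit_average T f n x - orbit_mean T f x| @[n --> \oo] --> 0.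
Proof.
move=> bf; have om := bounded_by_orbit_mean hT bf.
have oa n := bounded_by_orbit_average hT n bf.
have -> : 0 = \int[mu]_(x in setT) (cst 0 x : R).
  by rewrite Rintegral_cst// mul0r.
have C0 : 0 <= C + C.
  by have [x _] := probability_nonempty mu; rewrite addr_ge0// (bounded_by_ge0 x bf).
apply: (@bounded_convergence _ _ _ _ (C + C)) => //.
- by move=> n; exact: (bounded_by_norm (bounded_byB (oa n) om)).
- by split=> [|x]; rewrite /= ?normr0.
apply: filterS (birkhoff_ae hT bf) => x fx.
rewrite -(normr0 R) -(subrr (orbit_mean T f x)).
by apply: cvg_norm; apply: cvgB => //; exact: cvg_cst.
Qed.

Definition local_average f n x := n.+1%:R * orbit_integral T f n.+1%:R^-1 x.

Lemma bounded_by_local_average C f n : bounded_by C f ->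
  bounded_by C (local_average f n).
Proof.
move=> bf; have -> : C = `|n.+1%:R| * (C * n.+1%:R^-1).
  by rewrite ger0_norm// mulrCA mulfV ?mulr1// pnatr_eq0.
apply: (bounded_byM (bounded_by_cst _ _) (bounded_by_orbit_integral hT _ bf)).
by rewrite invr_ge0.
Qed.

(** On each orbit the local averages converge at almost every time, by Lebesgue's
    differentiation theorem. Hence the upper limit e of the deviations has
    integral 0 over a unit of time of each orbit, and by invariance of the
    measure its expectation is 0. *)
Lemma local_deviation C f : bounded_by C f ->
  \int[mu]_x `|f x - local_average f n x| @[n --> \oo] --> 0.
Proof.
move=> bf; have la n := bounded_by_local_average n bf.
have bdev n := bounded_by_norm (bounded_byB bf (la n)).
have [x0 _] := probability_nonempty mu.
have C0 : 0 <= C + C by rewrite addr_ge0// (bounded_by_ge0 x0 bf).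
pose dev n x := `|f x - local_average f n x|.
have devC x n : `|dev n x| <= C + C by have [_] := bdev n; exact.
pose e x := limn_sup (dev ^~ x).
have be : bounded_by (C + C) e.
  split=> [|x]; last exact: normr_limn_sup (devC x).
  apply: (measurable_fun_limn_sup (h := dev)) => [x _|x _|n].
  - by exists (C + C) => _ [n _ <-]; exact: le_trans (ler_norm _) (devC x n).
  - by exists 0 => _ [n _ <-]; exact: normr_ge0.
  - exact: (bdev n).1.
have e0 x : 0 <= e x.
  apply/ler_addgt0Pr => r r0.
  have [N /(_ _ (leqnn N)) /ltW] := limn_sup_lt (devC x) r0.
  by apply: le_trans; exact: normr_ge0.
have e_orbit x : \int[leb]_(s in `[0, 1]) e (T s x) = 0.
  have bo := bounded_by_orbit hT x be.
  have oo01 := @lebesgue_itv_lty R (BLeft 0) (BRight 1) isT isT.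
  have /integrableP [mo _] := itv_integrable bo oo01.
  rewrite /Rintegral (ae_eq_integral (cst 0%E))//; first by rewrite integral0.
  have := right_average_cvg (bounded_by_orbit hT x bf).
  apply: filterS; first exact: (ae_filter_ringOfSetsType leb).
  move=> s Fs; rewrite /= in_itv/= => /andP[s0 _]; congr EFin.
  have devs : dev n (T s x) @[n --> \oo] --> 0.
    rewrite -(normr0 R) -(subrr (f (T s x))); apply: cvg_norm; apply: cvgB.
      exact: cvg_cst.
    apply: cvg_trans (Fs s0); apply: near_eq_cvg; apply: nearW => n.
    by rewrite /local_average (orbit_integral_flow hT _ _ _ bf).
  by rewrite /e; have [_ ->] := cvg_limn_inf_sup devs.
have Ie : \int[mu]_x e x <= 0.
  have -> : \int[mu]_x e x = \int[leb]_(s in `[0, 1]) \int[mu]_(x in setT) e (T s x).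
    under [RHS]eq_Rintegral do rewrite (flow_expectation hT _ be).
    by rewrite Rintegral_cst_itv// subr0 mulr1.
  rewrite -(expectation_orbit_integral hT _ measurableT be)//.
  rewrite (_ : orbit_integral T e 1 = cst 0); last exact/funext.
  by rewrite Rintegral_cst// mul0r.
have -> : 0 = \int[mu]_(x in setT) (cst 0 x : R).
  by rewrite Rintegral_cst// mul0r.
apply: (@bounded_convergence _ _ _ _ (C + C)) => //.
  by split=> [|x]; rewrite /= ?normr0.
apply: filterS (ae_eq0_of_Rintegral be e0 Ie) => x ex.
apply/cvgrPdist_lt => r r0; have [N HN] := limn_sup_lt (devC x) r0.
exists N => // n /= /HN; rewrite -/(e x) ex add0r => dr.
by rewrite sub0r normrN ger0_norm ?normr_ge0.
Qed.

End small_means.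

(** * Integrals along one side of a box *)

Section fiber.
Context (R : realType).
Notation leb := (@lebesgue_measure R).

(** The averages of G over moving windows of fixed large length are small for most
    positions of the window. This is all that the ergodic theorem provides: along
    a generic orbit, the averages over windows of length sqrt u at u, to which the
    substitution leads, need not converge. *)
Definition small_window_means (G : R -> R) := forall e : R, 0 < e ->
  exists (L b : R), [/\ 0 < L, b <= e &
    mean_value (fun u => `|L^-1 * \int[leb]_(w in `[0, L]) G (u + w)|) b].

(** The powers of M in quadratic_phase_bound when a is at least theta M / 2: the
    first term is of order M and the others are bounded. *)
Lemma quadratic_phase_rescale (C C' K K' L a e k2 theta M W delta : R) :
  0 <= C -> 0 <= C' -> 0 <= K -> 0 <= k2 -> 0 < L -> 0 < theta ->
  1 <= M -> theta * M <= 2 * a -> 0 <= delta <= k2 * M ^+ 2 ->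
  0 <= W -> W <= L * (2 * e * (k2 * M ^+ 2) + K') -> 0 <= K' ->
  C / (2 * a) * W + L ^+ 2 * (2 * (C / (2 * a)) * C' +
     (K / (4 * a ^+ 2) + C / (4 * a ^+ 3)) * C' * delta) <=
  L * (C / theta * (2 * e * k2) * M + (C / theta * K' +
     L * (2 * (C / theta) * C' + (K / theta ^+ 2 + 2 * C / theta ^+ 3) * C' * k2))).
Proof.
move=> C0 C'0 K0 k20 L0 theta0 M1 tMa /andP[delta0 delta_le] W0 W_le K'0.
have M0 : 0 < M := lt_le_trans ltr01 M1.
have tM0 : 0 < theta * M by exact: mulr_gt0.
have a20 : 0 < 2 * a := lt_le_trans tM0 tMa.
have inv_le n : ((2 * a) ^+ n)^-1 <= ((theta * M) ^+ n)^-1.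
  rewrite lef_pV2 ?posrE ?exprn_gt0//; case: n => [//|n].
  by rewrite ler_pXn2r// nnegrE ltW.
have Ca : C / (2 * a) <= C / (theta * M).
  by rewrite ler_wpM2l//; exact: inv_le 1.
have Ca0 : 0 <= C / (2 * a) by rewrite divr_ge0// ltW.
have K3a : K / (4 * a ^+ 2) + C / (4 * a ^+ 3) <=
    K / (theta * M) ^+ 2 + 2 * C / (theta * M) ^+ 3.
  have a_neq0 : a != 0 by apply: contraTneq a20 => ->; rewrite mulr0 ltxx.
  have -> : C / (4 * a ^+ 3) = 2 * C / (2 * a) ^+ 3 by field.
  have -> : 4 * a ^+ 2 = (2 * a) ^+ 2 by ring.
  by apply: lerD; rewrite ler_wpM2l// mulr_ge0.
have K3t0 : 0 <= K / (theta * M) ^+ 2 + 2 * C / (theta * M) ^+ 3.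
  have i0 n : 0 <= ((theta * M) ^+ n)^-1 by rewrite invr_ge0 exprn_ge0// ltW.
  by apply: addr_ge0; rewrite mulr_ge0// mulr_ge0.
have Mi1 : M^-1 <= 1 by rewrite invf_le1.
have tC : 0 <= C / theta by rewrite divr_ge0// ltW.
have tC3 : 0 <= 2 * C / theta ^+ 3.
  by apply: divr_ge0; [exact: mulr_ge0|rewrite exprn_ge0// ltW].
apply: (@le_trans _ _ (C / (theta * M) * (L * (2 * e * (k2 * M ^+ 2) + K')) +
  L ^+ 2 * (2 * (C / (theta * M)) * C' +
   (K / (theta * M) ^+ 2 + 2 * C / (theta * M) ^+ 3) * C' * (k2 * M ^+ 2)))).
  apply: lerD; first exact: ler_pM.
  rewrite ler_wpM2l ?sqr_ge0//; apply: lerD; first by rewrite ler_wpM2r// ler_wpM2l.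
  apply: (@le_trans _ _ ((K / (theta * M) ^+ 2 + 2 * C / (theta * M) ^+ 3) * C' * delta)).
    by rewrite ler_wpM2r// ler_wpM2r.
  by rewrite ler_wpM2l// mulr_ge0.
have -> : C / (theta * M) * (L * (2 * e * (k2 * M ^+ 2) + K')) +
  L ^+ 2 * (2 * (C / (theta * M)) * C' +
   (K / (theta * M) ^+ 2 + 2 * C / (theta * M) ^+ 3) * C' * (k2 * M ^+ 2)) =
  L * (C / theta * (2 * e * k2) * M + (C / theta * K' * M^-1 +
    L * (2 * (C / theta) * C' * M^-1 + (K / theta ^+ 2 +
      2 * C / theta ^+ 3 * M^-1) * C' * k2))).
  by field; rewrite !gt_eqF.
rewrite ler_pM2l//; apply: lerD; first exact: lexx.
apply: lerD; first by rewrite ler_piMr// mulr_ge0.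
rewrite ler_pM2l//; apply: lerD.
  by rewrite ler_piMr//; apply: mulr_ge0 => //; apply: mulr_ge0.
by rewrite ler_wpM2r// ler_wpM2r// lerD2l ler_piMr.
Qed.

(** The segment [0, theta M] is estimated trivially. On [theta M, M], completing
    the square turns the phase into z^2 + q' with z of order M, and
    quadratic_phase_bound compares the integral with 1 / M times the integral of
    the window means of G over an interval whose length is of order M^2. The
    bound is uniform in r and in the lower order terms of the phase, since these
    depend on the remaining coordinates of a point of a box. *)
Lemma quadratic_fiber_small (C C' K K1 kappa : R) (F G : R -> R) :
  bounded_by C F -> (forall x y, `|F x - F y| <= K * `|x - y|) ->
  bounded_by C' G -> small_window_means G -> 0 <= kappa -> 0 <= K1 ->
  forall e : R, 0 < e -> exists A : R, forall M r p q : R, A < M ->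
    0 <= r <= kappa * M -> `|p| <= K1 ->
    (forall v, 0 <= v <= M -> `|p * v + q| <= K1 * (1 + M)) ->
    `|\int[leb]_(v in `[0, M]) (F (v + r) * G ((v + r) ^+ 2 + (p * v + q)))|
      <= e * M.
Proof.
move=> bF KF bG smallG kappa0 K10 e e0.
have C0 : 0 <= C := bounded_by_ge0 (0 : R) bF.
have C'0 : 0 <= C' := bounded_by_ge0 (0 : R) bG.
have K0 : 0 <= K.
  by have := KF 1 0; rewrite subr0 normr1 mulr1; exact: le_trans.
have CC0 : 0 <= C * C' by exact: mulr_ge0.
(* theta M is the length of the initial segment that is dropped. *)
pose theta := Num.min 1 (e / (4 * (C * C' + 1))).
have theta0 : 0 < theta.
  by rewrite lt_min ltr01/= divr_gt0// mulr_gt0// ltr_wpDl.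
have theta1 : theta <= 1 by rewrite ge_min lexx.
have theta_e : C * C' * theta <= e / 4.
  apply: (@le_trans _ _ ((C * C' + 1) * (e / (4 * (C * C' + 1))))).
    by apply: ler_pM; rewrite ?(ltW theta0)// ?lerDl// ge_min lexx orbT.
  rewrite le_eqVlt; apply/orP; left; apply/eqP; field.
  by rewrite gt_eqF// ltr_wpDl.
clearbody theta.
pose k2 := (kappa + 2) ^+ 2; have k2E : k2 = (kappa + 2) ^+ 2 by [].
have k20 : 0 < k2 by rewrite exprn_gt0// ltr_wpDl.
pose e1 := e * theta / (8 * (C + 1) * k2).
have C10 : 0 < C + 1 by rewrite ltr_wpDl.
have e10 : 0 < e1.
  apply: divr_gt0; first exact: mulr_gt0.
  by apply: mulr_gt0 => //; apply: mulr_gt0.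
have e1_e : C / theta * (2 * e1 * k2) <= e / 4.
  have -> : C / theta * (2 * e1 * k2) = (C / (C + 1)) * (e / 4).
    by rewrite /e1; field; rewrite !gt_eqF.
  by rewrite ler_piMl ?divr_ge0 ?(ltW e0)// ler_pdivrMr// mul1r lerDl.
clearbody e1 k2.
have [L [b [L0 be1 Gb]]] := smallG e1 e10.
have [K' HK'] := Gb e1 e10.
have bW := bounded_by_window (ltW L0) bG.
have window_le U : 0 <= U ->
    \int[leb]_(u in `[0, U]) `|\int[leb]_(w in `[0, L]) G (u + w)| <=
    L * (2 * e1 * U + K').
  move=> U0; have := HK' U U0.
  have -> : \int[leb]_(u in `[0, U]) `|L^-1 * \int[leb]_(w in `[0, L]) G (u + w)| =
      L^-1 * \int[leb]_(u in `[0, U]) `|\int[leb]_(w in `[0, L]) G (u + w)|.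
    rewrite -(RintegralZ_itv _ _ _ (bounded_by_norm bW)).
    by apply: eq_Rintegral => u _; rewrite normrM ger0_norm// invr_ge0 ltW.
  rewrite ler_norml => /andP[_]; rewrite lerBlDr ler_pdivrMl// => /le_trans; apply.
  rewrite ler_wpM2l// ?(ltW L0)//.
  have : b * U <= e1 * U by rewrite ler_wpM2r.
  by lra.
pose D := C / theta * `|K'| + L * (2 * (C / theta) * C' +
  (K / theta ^+ 2 + 2 * C / theta ^+ 3) * C' * k2).
have D0 : 0 <= D.
  have ti0 : 0 <= theta^-1 by rewrite invr_ge0 ltW.
  have ti20 : 0 <= (theta ^+ 2)^-1 by rewrite invr_ge0 sqr_ge0.
  have ti30 : 0 <= (theta ^+ 3)^-1 by rewrite invr_ge0 exprn_ge0// ltW.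
  have [L0' k20'] := (ltW L0, ltW k20).
  by rewrite /D; do ![apply: addr_ge0|apply: mulr_ge0].
exists (1 + 2 * K1 / theta ^+ 2 + 4 * D / e) => M r p q AM /andP[r0 rM] pK1 pq.
have K1t0 : 0 <= 2 * K1 / theta ^+ 2.
  by apply: divr_ge0; [exact: mulr_ge0|exact: sqr_ge0].
have De0 : 0 <= 4 * D / e.
  by apply: divr_ge0; [exact: mulr_ge0|exact: ltW].
have M1 : 1 <= M by move: K1t0 De0 AM; clear; lra.
have M0 : 0 < M := lt_le_trans ltr01 M1.
have K1M : 2 * K1 <= theta ^+ 2 * M.
  by rewrite [leRHS]mulrC -ler_pdivrMr ?exprn_gt0//; move: De0 AM; clear; lra.
have DM : D <= e / 4 * M.
  have : 4 * D / e <= M by move: K1t0 AM; clear; lra.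
  by rewrite ler_pdivrMr//; clear; lra.
have theta2 : theta ^+ 2 <= theta by rewrite expr2 ler_piMl// ltW.
have K1M' : 2 * K1 <= theta * M.
  by apply: le_trans K1M _; rewrite ler_wpM2r// ltW.
have tM0 : 0 <= theta * M by rewrite mulr_ge0 ?ltW.
have tMM : theta * M <= M by rewrite ler_piMl// ltW.
pose H v := F (v + r) * G ((v + r) ^+ 2 + (p * v + q)).
have bH : bounded_by (C * C') H.
  apply: bounded_byM; first exact: bounded_by_shift.
  apply: (bounded_by_comp (u := fun v : R => (v + r) ^+ 2 + (p * v + q))) bG.
  apply: measurable_funD.
    by apply: measurable_funX; exact: measurable_funD.
  by apply: measurable_funD => //; exact: measurable_funM.
rewrite -/H (Rintegral_itvD bH tM0 tMM).
have first_le : `|\int[leb]_(v in `[0, theta * M]) H v| <= e / 4 * M.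
  apply: le_trans (le_norm_itv tM0 bH) _.
  by rewrite subr0 mulrA ler_wpM2r// ltW.
pose a := theta * M + r + p / 2; pose b' := M + r + p / 2.
pose q' := q - p ^+ 2 / 4 - p * r.
have ab : a <= b' by rewrite /a /b' !lerD2r.
have pK1' : - K1 <= p <= K1 by rewrite -ler_norml.
have a_ge : theta * M / 2 <= a.
  by rewrite /a; case/andP: pK1' => + _; move: K1M' r0 tM0; clear; lra.
have tM_gt0 : 0 < theta * M by rewrite mulr_gt0.
have a0 : 0 < a by apply: lt_le_trans a_ge; rewrite divr_gt0.
have second_eq : \int[leb]_(v in `[theta * M, M]) H v =
    \int[leb]_(z in `[a, b']) (F (z + - (p / 2)) * G (z ^+ 2 + q')).
  have bPhi : bounded_by (C * C') (fun z : R => F (z + - (p / 2)) * G (z ^+ 2 + q')).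
    apply: bounded_byM; first exact: bounded_by_shift.
    apply: (bounded_by_comp (u := fun v : R => v ^+ 2 + q')) bG.
    by apply: measurable_funD => //; exact: measurable_funX.
  have := Rintegral_translation (theta * M) M (r + p / 2) bPhi.
  rewrite !addrA -/a -/b' => <-; apply: eq_Rintegral => v _.
  rewrite /H; congr (F _ * G _); first by ring.
  by rewrite /q'; field.
have a_low : 0 <= a ^+ 2 + q'.
  have -> : a ^+ 2 + q' = (theta * M + r) ^+ 2 + (p * (theta * M) + q).
    by rewrite /a /q'; field.
  have := pq (theta * M); rewrite tM0 tMM => /(_ isT).
  rewrite ler_norml => /andP[h _].
  have : (theta * M) ^+ 2 <= (theta * M + r) ^+ 2.
    by rewrite ler_sqr ?nnegrE ?addr_ge0// lerDl.
  have : K1 * (1 + M) <= (theta * M) ^+ 2.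
    apply: (@le_trans _ _ (2 * K1 * M)); first by move: K10 M1; clear; nra.
    by rewrite exprMn [M ^+ 2]expr2 mulrA ler_wpM2r// ltW.
  by lra.
have b_up : b' ^+ 2 + q' <= k2 * M ^+ 2.
  have -> : b' ^+ 2 + q' = (M + r) ^+ 2 + (p * M + q).
    by rewrite /b' /q'; field.
  have := pq M; rewrite lexx (ltW M0) => /(_ isT).
  rewrite ler_norml => /andP[_ h].
  have : (M + r) ^+ 2 <= ((kappa + 1) * M) ^+ 2.
    rewrite ler_sqr ?nnegrE ?addr_ge0 ?mulr_ge0 ?addr_ge0 ?(ltW M0)//.
    by move: rM; clear; lra.
  have : K1 * (1 + M) <= M ^+ 2.
    have : 2 * K1 <= M by exact: le_trans tMM.
    by move: K10 M1; clear; nra.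
  have : 0 <= kappa * M ^+ 2 by rewrite mulr_ge0 ?sqr_ge0.
  by rewrite k2E; move: h; clear; nra.
have U0 : 0 <= k2 * M ^+ 2 by rewrite mulr_ge0 ?sqr_ge0 ?(ltW k20).
have ab2 : a ^+ 2 + q' <= b' ^+ 2 + q'.
  by rewrite lerD2r ler_sqr ?nnegrE ?(ltW a0)// (le_trans (ltW a0)).
have window_ab : \int[leb]_(u in `[a ^+ 2 + q', b' ^+ 2 + q'])
    `|\int[leb]_(w in `[0, L]) G (u + w)| <= L * (2 * e1 * (k2 * M ^+ 2) + `|K'|).
  apply: (@le_trans _ _ (L * (2 * e1 * (k2 * M ^+ 2) + K'))); last first.
    by rewrite ler_wpM2l ?(ltW L0)// lerD2l ler_norm.
  apply: le_trans (window_le _ U0).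
  rewrite (Rintegral_itvD (bounded_by_norm bW) a_low (le_trans ab2 b_up)).
  rewrite (Rintegral_itvD (bounded_by_norm bW) ab2 b_up).
  rewrite [leRHS]addrCA lerDl addr_ge0//; exact: Rintegral_ge0.
have KF' x y : `|F (x + - (p / 2)) - F (y + - (p / 2))| <= K * `|x - y|.
  apply: le_trans (KF _ _) _.
  by have -> : x + - (p / 2) - (y + - (p / 2)) = x - y by ring.
have := quadratic_phase_bound q' L0 a0 ab (bounded_by_shift (- (p / 2)) bF) KF' bG.
rewrite -second_eq; set I2 := \int[leb]_(v in `[theta * M, M]) H v => I2_le.
have second_le : `|I2| <= e / 4 * M + D.
  rewrite -(ler_pM2l L0); apply: le_trans I2_le _.
  have tMa : theta * M <= 2 * a by rewrite [leRHS]mulrC -ler_pdivrMr.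
  have delta_le : 0 <= b' ^+ 2 - a ^+ 2 <= k2 * M ^+ 2.
    apply/andP; split; first by rewrite subr_ge0 -(lerD2r q').
    by apply: le_trans b_up; rewrite lerD2l; move: a_low; clear; lra.
  have W0 := Rintegral_ge0 leb (D := `[a ^+ 2 + q', b' ^+ 2 + q']%classic)
    (fun u _ => normr_ge0 (\int[leb]_(w in `[0, L]) G (u + w))).
  apply: le_trans (quadratic_phase_rescale C0 C'0 K0 (ltW k20) L0 theta0 M1 tMa
    delta_le W0 window_ab (normr_ge0 K')) _.
  by rewrite ler_pM2l// lerD2r ler_wpM2r// ltW.
apply: le_trans (ler_normD _ _) _; apply: le_trans (lerD first_le second_le) _.
by have : 0 <= e * M by [rewrite mulr_ge0 ?ltW]; lra.
Qed.

End fiber.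

(** * Averages over boxes *)

Section box_mean.
Context (R : realType) (k : nat).
Notation leb := (@lebesgue_measure R).
Implicit Types (M t : k.-tuple R) (F G : R -> R) (H : k.-tuple R -> R).

Definition box_mean H M : R :=
  (\prod_(j < k) tnth M j)^-1 * \int[lebesgue_tuple R k]_(t in box M) H t.

Lemma bounded_by_box_integrable C M H : (forall j, 0 <= tnth M j) ->
  bounded_by C H -> (lebesgue_tuple R k).-integrable (box M) (EFin \o H).
Proof.
move=> M0 bH; apply: bounded_by_integrable bH; first exact: measurable_box.
exact: lebesgue_tuple_box_lty.
Qed.

Lemma box_meanD C C' H H' M : (forall j, 0 < tnth M j) ->
  bounded_by C H -> bounded_by C' H' ->
  box_mean (fun t => H t + H' t) M = box_mean H M + box_mean H' M.
Proof.
move=> M0 bH bH'; rewrite /box_mean -mulrDr; congr (_ * _).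
have M0' j : 0 <= tnth M j by exact/ltW.
by rewrite RintegralD//; [exact: measurable_box|
  exact: (bounded_by_box_integrable M0' bH)|exact: (bounded_by_box_integrable M0' bH')].
Qed.

Lemma box_meanZ C r H M : (forall j, 0 < tnth M j) -> bounded_by C H ->
  box_mean (fun t => r * H t) M = r * box_mean H M.
Proof.
move=> M0 bH; rewrite /box_mean mulrCA; congr (_ * _).
have M0' j : 0 <= tnth M j by exact/ltW.
rewrite RintegralZl//; first exact: measurable_box.
exact: (bounded_by_box_integrable M0' bH).
Qed.

Lemma box_mean_cst r M : (forall j, 0 < tnth M j) -> box_mean (fun=> r) M = r.
Proof.
move=> M0; have M0' j : 0 <= tnth M j by exact/ltW.
rewrite /box_mean Rintegral_cst; last exact: measurable_box.
have -> : fine (lebesgue_tuple R k (box M)) = \prod_(j < k) tnth M j.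
  by rewrite lebesgue_tuple_box.
by rewrite mulrCA mulVf ?mulr1// gt_eqF// prodr_gt0.
Qed.

Lemma le_norm_box_mean C C' H H' M : (forall j, 0 < tnth M j) ->
  bounded_by C H -> bounded_by C' H' -> (forall t, `|H t| <= H' t) ->
  `|box_mean H M| <= box_mean H' M.
Proof.
move=> M0 bH bH' HH'; have M0' j : 0 <= tnth M j by exact/ltW.
rewrite /box_mean normrM ger0_norm ?invr_ge0 ?prodr_ge0//.
rewrite ler_wpM2l ?invr_ge0 ?prodr_ge0//.
have mb := measurable_box M.
apply: le_trans (le_normr_Rintegral mb (bounded_by_box_integrable M0' bH)) _.
apply: le_Rintegral => //; first exact: bounded_by_box_integrable (bounded_by_norm bH).
exact: bounded_by_box_integrable bH'.
Qed.

Lemma box_mean_fiber C e M H (j : 'I_k) : (forall i, 0 < tnth M i) ->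
  bounded_by C H ->
  (forall t, box M t ->
    `|\int[leb]_(v in `[0, tnth M j]) H (set_coord t j v)| <= e * tnth M j) ->
  `|box_mean H M| <= e.
Proof.
move=> M0 bH fib; have M0' i : 0 <= tnth M i by exact/ltW.
have P0 : 0 < \prod_(i < k) tnth M i by exact: prodr_gt0.
rewrite /box_mean normrM ger0_norm ?invr_ge0 ?(ltW P0)//.
rewrite mulrC ler_pdivrMr// -(ler_pM2l (M0 j)).
by apply: le_trans (box_fiber_bound M0' bH fib) _; rewrite mulrAC mulrC mulrA.
Qed.

Lemma max_coord M : (0 < k)%N -> exists j : 'I_k, forall i, tnth M i <= tnth M j.
Proof.
move=> k0.
case: (@Order.TotalTheory.arg_maxP _ _ 'I_k (Ordinal k0) xpredT (tnth M)) => //.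
by move=> j _ Hj; exists j => i; exact: Hj.
Qed.

Definition other_coords t (j : 'I_k) : R := \sum_(i < k | i != j) `|tnth t i|.

Lemma norm1_set_coord t (j : 'I_k) v : 0 <= v ->
  norm1 (set_coord t j v) = v + other_coords t j.
Proof.
move=> v0; rewrite /norm1 (bigD1 j)//= tnth_set_coord eqxx ger0_norm//.
congr (_ + _); apply: eq_bigr => i /negbTE ij.
by rewrite tnth_set_coord ij.
Qed.

Lemma other_coords_box M t (j : 'I_k) : box M t ->
  (forall i, tnth M i <= tnth M j) ->
  0 <= other_coords t j <= k%:R * tnth M j.
Proof.
move=> tM Mj; have Mj0 : 0 <= tnth M j.
  by have /andP[] := tM j; exact: le_trans.
apply/andP; split; first exact: sumr_ge0.
apply: (@le_trans _ _ (\sum_(i < k) tnth M j)); last first.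
  by rewrite sumr_const card_ord mulr_natl.
rewrite /other_coords big_mkcond/=; apply: ler_sum => i _; case: ifP => // _.
by have /andP[t0 tMi] := tM i; rewrite ger0_norm// (le_trans tMi).
Qed.

Lemma measurable_norm1 : measurable_fun setT (@norm1 R k).
Proof.
rewrite /norm1; apply: measurable_sum => i.
by apply: measurableT_comp => //; exact: measurable_tnth.
Qed.

Lemma bounded_by_norm1 C F : bounded_by C F ->
  bounded_by C (fun t => F (norm1 t)).
Proof. by apply: bounded_by_comp; exact: measurable_norm1. Qed.

(** The integral is taken first along the longest side, of length m. The sum r of
    the other coordinates is then at most k m, so that the errors at both ends of
    [r, m + r] are small multiples of m. Along a shorter side r could be much
    larger than the length of the side. *)
Lemma box_mean_norm1 C F b : (0 < k)%N -> bounded_by C F -> mean_value F b ->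
  forall e : R, 0 < e -> exists A : R, forall M, (forall j, A < tnth M j) ->
    `|box_mean (fun t => F (norm1 t)) M - b| <= e.
Proof.
move=> k0 bF Fb e e0.
pose eta := e / (2 * (2 * k%:R + 1)).
have k21 : 0 < 2 * k%:R + 1 :> R by rewrite ltr_wpDl.
have eta0 : 0 < eta by rewrite divr_gt0 ?mulr_gt0.
have [K HK] := Fb eta eta0.
exists (4 * `|K| / e) => M AM.
have M0 i : 0 < tnth M i.
  by apply: le_lt_trans (AM i); rewrite divr_ge0 ?mulr_ge0 ?(ltW e0).
have [j Mj] := max_coord M k0.
have bH := bounded_byB (bounded_by_norm1 bF) (bounded_by_cst (k.-tuple R) b).
have -> : box_mean (fun t => F (norm1 t)) M - b =
    box_mean (fun t => F (norm1 t) - b) M.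
  rewrite (box_meanD M0 (bounded_by_norm1 bF) (bounded_by_cst (k.-tuple R) (- b))).
  by rewrite box_mean_cst.
apply: (box_mean_fiber M0 bH (j := j)) => t tM.
have /andP[r0 rM] := other_coords_box tM Mj.
set r := other_coords t j in r0 rM.
set m := tnth M j; have m0 : 0 < m by exact: M0.
have -> : \int[leb]_(v in `[0, m]) (F (norm1 (set_coord t j v)) - b) =
    (\int[leb]_(s in `[0, m + r]) F s - b * (m + r)) -
    (\int[leb]_(s in `[0, r]) F s - b * r).
  transitivity (\int[leb]_(v in `[0, m]) (F (v + r) - b)).
    apply: eq_Rintegral => v; rewrite inE/= in_itv/= => /andP[v0 _].
    by rewrite norm1_set_coord.
  rewrite (RintegralB_itv _ _ (bounded_by_shift r bF) (bounded_by_cst _ b)).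
  rewrite (Rintegral_translation _ _ _ bF) add0r Rintegral_cst_itv ?(ltW m0)//.
  have rmr : r <= m + r by rewrite lerDr ltW.
  by rewrite (Rintegral_itvD bF r0 rmr) subr0; ring.
apply: le_trans (ler_normB _ _) _.
have mr0 : 0 <= m + r by rewrite addr_ge0// ltW.
apply: le_trans (lerD (HK _ mr0) (HK _ r0)) _.
have Km : 2 * K <= e / 2 * m.
  have : 4 * `|K| / e <= m by exact: ltW (AM j).
  by rewrite ler_pdivrMr//; have := ler_norm K; clear; lra.
have etaE : eta * ((2 * k%:R + 1) * m) = e / 2 * m.
  by rewrite /eta; field; rewrite gt_eqF.
have : eta * (m + 2 * r) <= eta * ((2 * k%:R + 1) * m).
  by rewrite ler_wpM2l ?(ltW eta0)//; move: rM; rewrite -/m; clear; lra.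
by rewrite etaE; move: Km; clear; lra.
Qed.

Definition affine (Q : k.-tuple R -> R) := exists (b : R) (a : 'I_k -> R),
  forall t, Q t = b + \sum_(i < k) a i * tnth t i.

Lemma measurable_affine Q : affine Q -> measurable_fun setT Q.
Proof.
move=> [b [a /funext ->]]; apply: measurable_funD => //.
apply: measurable_sum => i; apply: measurable_funM => //; exact: measurable_tnth.
Qed.

Lemma bounded_by_phase C Q G : affine Q -> bounded_by C G ->
  bounded_by C (fun t => G (norm1 t ^+ 2 + Q t)).
Proof.
move=> aQ; apply: (bounded_by_comp (u := fun t => norm1 t ^+ 2 + Q t)).
apply: measurable_funD; last exact: measurable_affine.
by apply: measurable_funX; exact: measurable_norm1.
Qed.

Lemma box_mean_quadratic_lipschitz C C' K F G Q : (0 < k)%N -> affine Q ->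
  bounded_by C F -> (forall x y, `|F x - F y| <= K * `|x - y|) ->
  bounded_by C' G -> small_window_means G ->
  forall e : R, 0 < e -> exists A : R, forall M, (forall j, A < tnth M j) ->
    `|box_mean (fun t => F (norm1 t) * G (norm1 t ^+ 2 + Q t)) M| <= e.
Proof.
move=> k0 aQ bF KF bG smallG e e0; have [b [a QE]] := aQ.
pose K1 := `|b| + \sum_(i < k) `|a i|.
have K10 : 0 <= K1 by rewrite addr_ge0// sumr_ge0.
have [A HA] := quadratic_fiber_small bF KF bG smallG (ler0n R k) K10 e0.
exists (Num.max 0 A) => M AM.
have [M0 AM'] : (forall i, 0 < tnth M i) /\ (forall i, A < tnth M i).
  by split=> i; have := AM i; rewrite gt_max => /andP[].
have [j Mj] := max_coord M k0.
have bH := bounded_byM (bounded_by_norm1 bF) (bounded_by_phase aQ bG).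
apply: (box_mean_fiber M0 bH (j := j)).
move=> t tM; set m := tnth M j.
have Qv v : Q (set_coord t j v) =
    a j * v + (b + \sum_(i < k | i != j) a i * tnth t i).
  rewrite QE (bigD1 j)//= tnth_set_coord eqxx addrCA; congr (_ + (_ + _)).
  by apply: eq_bigr => i /negbTE ij; rewrite tnth_set_coord ij.
set q := b + _ in Qv.
have <- : \int[leb]_(v in `[0, m])
    (F (v + other_coords t j) * G ((v + other_coords t j) ^+ 2 + (a j * v + q))) =
    \int[leb]_(v in `[0, m])
    (F (norm1 (set_coord t j v)) *
     G (norm1 (set_coord t j v) ^+ 2 + Q (set_coord t j v))).
  apply: eq_Rintegral => v; rewrite inE/= in_itv/= => /andP[v0 _].
  by rewrite Qv norm1_set_coord.
apply: HA; first exact: AM'.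
- exact: (other_coords_box tM Mj).
- by rewrite /K1 (bigD1 j)//= addrCA lerDl addr_ge0// sumr_ge0.
move=> v /andP[v0 vm]; rewrite -Qv QE.
have m0 : 0 <= m := le_trans v0 vm.
apply: le_trans (ler_normD _ _) _; rewrite /K1 mulrDl mulrDr mulr1.
apply: lerD; first by rewrite lerDl mulr_ge0.
apply: le_trans (ler_norm_sum _ _ _) _; rewrite mulr_suml.
apply: ler_sum => i _; rewrite normrM ler_wpM2l// tnth_set_coord.
have m1 : m <= 1 + m by rewrite lerDr.
case: ifP => _; first by rewrite ger0_norm// (le_trans vm).
by have /andP[t0 tMi] := tM i; rewrite ger0_norm// (le_trans tMi)// (le_trans (Mj i)).
Qed.

Definition lipschitz_approximable F := forall e : R, 0 < e ->
  exists (F' : R -> R) (C K b : R), [/\ bounded_by C F',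
    forall x y, `|F' x - F' y| <= K * `|x - y|, b <= e &
    mean_value (fun s => `|F s - F' s|) b].

(** The difference F - F' is estimated in mean, with G replaced by its bound, and
    F' is treated by box_mean_quadratic_lipschitz. *)
Lemma box_mean_quadratic C C' F G Q : (0 < k)%N -> affine Q ->
  bounded_by C F -> lipschitz_approximable F ->
  bounded_by C' G -> small_window_means G ->
  forall e : R, 0 < e -> exists A : R, forall M, (forall j, A < tnth M j) ->
    `|box_mean (fun t => F (norm1 t) * G (norm1 t ^+ 2 + Q t)) M| <= e.
Proof.
move=> k0 aQ bF FF' bG smallG e e0.
have C'0 : 0 <= C' := bounded_by_ge0 (0 : R) bG.
pose e1 := e / (4 * (C' + 1)).
have C'1 : 0 < C' + 1 by rewrite ltr_wpDl.
have e10 : 0 < e1 by rewrite divr_gt0 ?mulr_gt0.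
have C'e1 : C' * (2 * e1) <= e / 2.
  have -> : e / 2 = (C' + 1) * (2 * e1) by rewrite /e1; field; rewrite gt_eqF.
  by rewrite ler_wpM2r ?lerDl// mulr_ge0 ?(ltW e10).
have [F' [C1 [K [b [bF' KF' be1 FF'b]]]]] := FF' e1 e10.
have bD := bounded_by_norm (bounded_byB bF bF').
have [A1 HA1] := box_mean_norm1 k0 bD FF'b e10.
have e20 : 0 < e / 2 by rewrite divr_gt0.
have [A2 HA2] := box_mean_quadratic_lipschitz k0 aQ bF' KF' bG smallG e20.
exists (Num.max 0 (Num.max A1 A2)) => M AM.
have [M0 A1M A2M] : [/\ forall i, 0 < tnth M i, forall i, A1 < tnth M i &
    forall i, A2 < tnth M i].
  by split=> i; have := AM i; rewrite !gt_max => /and3P[].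
have bFt := bounded_by_norm1 (bounded_byB bF bF').
have bGt := bounded_by_phase aQ bG.
have -> : (fun t => F (norm1 t) * G (norm1 t ^+ 2 + Q t)) =
  (fun t => (F (norm1 t) - F' (norm1 t)) * G (norm1 t ^+ 2 + Q t) +
            F' (norm1 t) * G (norm1 t ^+ 2 + Q t)).
  by apply/funext => t; rewrite mulrBl subrK.
rewrite (box_meanD M0 (bounded_byM bFt bGt) (bounded_byM (bounded_by_norm1 bF') bGt)).
have -> : e = e / 2 + e / 2 by field.
apply: le_trans (ler_normD _ _) _; apply: lerD; last exact: HA2.
apply: le_trans C'e1.
apply: (@le_trans _ _ (box_mean (fun t => C' * `|F (norm1 t) - F' (norm1 t)|) M)).
  apply: (le_norm_box_mean M0 (bounded_byM bFt bGt)).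
    exact: (bounded_byM (bounded_by_cst _ C') (bounded_by_norm bFt)).
  by move=> t; rewrite normrM mulrC ler_wpM2r//; exact: bG.2.
rewrite (box_meanZ _ M0 (bounded_by_norm bFt)) ler_wpM2l//.
have := HA1 M A1M; rewrite ler_norml => /andP[_]; move: be1; clear; lra.
Qed.

(** Subtracting the constant g from G leaves a function with small window means,
    whose contribution tends to 0. *)
Lemma box_mean_product C C' F G Q b g : (0 < k)%N -> affine Q ->
  bounded_by C F -> lipschitz_approximable F -> mean_value F b ->
  bounded_by C' G -> small_window_means (fun u => G u - g) ->
  box_mean (fun t => F (norm1 t) * G (norm1 t ^+ 2 + Q t)) M
    @[M --> min_pinfty R k] --> b * g.
Proof.
move=> k0 aQ bF FF' Fb bG smallG; apply/cvgrPdist_le => e e0.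
have e20 : 0 < e / 2 by rewrite divr_gt0.
have bGg := bounded_byB bG (bounded_by_cst R g).
have [A1 HA1] := box_mean_quadratic k0 aQ bF FF' bGg smallG e20.
have g10 : 0 < `|g| + 1 by rewrite ltr_wpDl.
have e30 : 0 < e / (2 * (`|g| + 1)) by rewrite divr_gt0 ?mulr_gt0.
have [A2 HA2] := box_mean_norm1 k0 bF Fb e30.
exists (Num.max 0 (Num.max A1 A2)) => // M /= AM.
have [M0 A1M A2M] : [/\ forall i, 0 < tnth M i, forall i, A1 < tnth M i &
    forall i, A2 < tnth M i].
  by split=> i; have := AM i; rewrite !gt_max => /and3P[].
have bFt := bounded_by_norm1 bF.
have -> : (fun t => F (norm1 t) * G (norm1 t ^+ 2 + Q t)) =
  (fun t => F (norm1 t) * (G (norm1 t ^+ 2 + Q t) - g) + g * F (norm1 t)).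
  by apply/funext => t; rewrite mulrBr [g * _]mulrC subrK.
rewrite (box_meanD M0 (bounded_byM bFt (bounded_by_phase aQ bGg))
  (bounded_byM (bounded_by_cst _ g) bFt)).
rewrite (box_meanZ _ M0 bFt) distrC -addrA [b * g]mulrC -mulrBr.
have -> : e = e / 2 + e / 2 by field.
apply: le_trans (ler_normD _ _) _; apply: lerD; first exact: HA1.
rewrite normrM; apply: le_trans (ler_wpM2l (normr_ge0 g) (HA2 M A2M)) _.
have -> : e / 2 = (`|g| + 1) * (e / (2 * (`|g| + 1))) by field; rewrite gt_eqF.
by rewrite ler_wpM2r ?lerDl// ltW.
Qed.

End box_mean.

(** * Affine phases, bounded versions and generic orbits *)

Section affine_eval.
Context (R : realType) (k : nat).

Lemma affine_mpoly_eval (P : mpoly k int) : (mpoly_degree P <= 1)%N ->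
  affine (@mpoly_eval R k P).
Proof.
move=> P1; rewrite /affine /mpoly_eval /mmap.
have affine_monomial m : m \in msupp P -> exists (b : R) (a : 'I_k -> R),
    forall t : k.-tuple R, intr (mcoeff m P) * mmap1 (tnth t) m =
      b + \sum_(i < k) a i * tnth t i.
  move=> /msize_mdeg_lt mP; have : (mdeg m <= 1)%N.
    rewrite -ltnS; apply: leq_trans mP _.
    by move: P1; rewrite /mpoly_degree; case: (msize P).
  rewrite leq_eqVlt ltnS leqn0 => /orP[/mdeg1P[i /eqP mE]|].
    exists 0, (fun j => if j == i then intr (mcoeff m P) else 0) => t.
    have -> : mmap1 (tnth t) m = tnth t i by rewrite mE mmap1U.
    rewrite add0r (bigD1 i)//= eqxx big1 ?addr0// => j /negbTE ->.
    by rewrite mul0r.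
  rewrite mdeg_eq0 => /eqP mE; exists (intr (mcoeff m P)), (fun=> 0) => t.
  have -> : mmap1 (tnth t) m = 1 by rewrite mE mmap11.
  by rewrite mulr1 big1 ?addr0// => i _; rewrite mul0r.
elim: (msupp P : seq _) affine_monomial => [|m s IH] Hs.
  by exists 0, (fun=> 0) => t; rewrite big_nil big1 ?addr0// => i _; rewrite mul0r.
have [b [a Ha]] := Hs m (mem_head _ _).
have [|b' [a' Ha']] := IH; first by move=> n ns; apply: Hs; rewrite inE ns orbT.
exists (b + b'), (fun i => a i + a' i) => t.
rewrite big_cons Ha Ha' addrACA -big_split/=; congr (_ + _).
by apply: eq_bigr => i _; rewrite mulrDl.
Qed.

Lemma affineZ (c : R) (Q : k.-tuple R -> R) : affine Q -> affine (fun t => c * Q t).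
Proof.
move=> [b [a QE]]; exists (c * b), (fun i => c * a i) => t.
by rewrite QE mulrDr mulr_sumr; congr (_ + _); apply: eq_bigr => i _; rewrite mulrA.
Qed.

End affine_eval.

Section bounded_version.
Context (R : realType) d (X : measurableType d) (mu : probability X R).

Lemma Lfun_bounded_version (f : X -> R) : f \in Lfun mu +oo%E ->
  measurable_fun setT f /\
  exists (C : R) (f' : X -> R), bounded_by C f' /\ {ae mu, forall x, f x = f' x}.
Proof.
move=> /andP[]; rewrite !inE => /= mf; rewrite /finite_norm unlock.
case: ifPn => [_|/negP[]]; last first.
  by have : (0 < mu [set: X])%E by rewrite probability_setT.
move=> /(ess_supr_bounded (f := fun x => `|f x|))[C fC].
split=> //.
exists `|C|, (fun x => f x * \1_[set x | `|f x| <= C] x); split.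
  split=> [|x].
    apply: measurable_funM => //; apply: measurable_indic.
    rewrite -[X in measurable X]setTI.
    rewrite (_ : mkset _ = (fun x => `|f x|) @^-1` `]-oo, C]%classic).
      have mnf : measurable_fun setT (fun x => `|f x|) by exact: measurableT_comp.
      by apply: mnf => //; exact: measurable_itv.
    by apply/seteqP; split => x /=; rewrite in_itv.
  rewrite indicE; have [|_] := boolP (x \in _); last by rewrite mulr0 normr0.
  by rewrite inE/= mulr1 => /le_trans; apply; exact: ler_norm.
by apply: filterS fC => x /= fC; rewrite indicE mem_set ?mulr1.
Qed.

Context (T : R -> X -> X) (hT : measurable_flow mu T).

(** For each y the exceptional points x form the preimage of a null set under the
    measure preserving map T (u y); Fubini's theorem exchanges x and y. *)
Lemma ae_orbit d' (Y : measurableType d') (m : {sigma_finite_measure set Y -> \bar R})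
    (u : Y -> R) (f f' : X -> R) :
  measurable_fun setT u -> {ae mu, forall x, f x = f' x} ->
  {ae mu, forall x, {ae m, forall y, f (T (u y) x) = f' (T (u y) x)}}.
Proof.
move=> mu_ [Z [mZ Z0 ffZ]].
pose A : set (X * Y) := (fun z => T (u z.2) z.1) @^-1` Z.
have mA : measurable A.
  rewrite -[X in measurable X]setTI.
  have mT : measurable_fun setT (fun z : X * Y => T (u z.2) z.1).
    have [_ _ _ mT] := hT.
    apply: (measurableT_comp (f := fun p : R * X => T p.1 p.2)
      (g := fun z : X * Y => (u z.2, z.1))) => //.
    apply/measurable_fun_pair; last exact: measurable_fst.
    by apply: measurableT_comp mu_ _; exact: measurable_snd.
  by apply: mT.
have := @indic_fubini_tonelli _ _ X Y R mu m A mA.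
rewrite indic_fubini_tonelli_FE// indic_fubini_tonelli_GE//.
have -> : mu \o ysection A = cst 0%E.
  apply/funext => y /=.
  transitivity (mu (T (u y) @^-1` Z)).
    by congr (mu _); apply/seteqP; split => x; rewrite /ysection/= inE.
  by have [_ _ /(_ (u y)) [_ ->]] := hT.
rewrite integral0 => I0.
have mxs : measurable_fun setT (m \o xsection A) by exact: measurable_fun_xsection.
have I0' : (\int[mu]_x `|(m \o xsection A) x| = 0)%E.
  by rewrite -[RHS]I0; apply: eq_integral => x _; rewrite gee0_abs.
have /(ae_eq_integral_abs mu measurableT mxs) := I0'.
apply: filterS => x /(_ I) /= mx0.
exists (xsection A x); split=> //; first exact: measurable_xsection.
move=> y /= fy; rewrite /xsection/= inE; apply: ffZ => /= fx.
exact: fy.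
Qed.

End bounded_version.

Section generic_orbits.
Context (R : realType) d (X : measurableType d) (mu : probability X R).
Context (T : R -> X -> X) (hT : measurable_flow mu T).
Notation leb := (@lebesgue_measure R).
Implicit Types (f : X -> R) (C : R).

Lemma local_average_lipschitz C f n x : bounded_by C f -> forall s t : R,
  `|local_average T f n (T s x) - local_average T f n (T t x)| <=
  n.+1%:R * (C + C) * `|s - t|.
Proof.
move=> bf; suff le s t : s <= t ->
    `|local_average T f n (T s x) - local_average T f n (T t x)| <=
    n.+1%:R * (C + C) * `|s - t|.
  move=> s t; have [st|/ltW ts] := leP s t; first exact: le.
  by rewrite distrC [`|s - t|]distrC; exact: le.
move=> st; rewrite /local_average -mulrBr normrM normr_nat -mulrA ler_wpM2l//.
rewrite !(orbit_integral_flow hT _ _ _ bf).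
set h := n.+1%:R^-1; have h0 : 0 <= h by rewrite invr_ge0.
have bo := bounded_by_orbit hT x bf.
have shs : s <= h + s by rewrite lerDr.
have tht : t <= h + t by rewrite lerDr.
have hst : h + s <= h + t by rewrite lerD2l.
have := Rintegral_itvD bo shs hst; rewrite (Rintegral_itvD bo st tht) => E.
have -> : \int[leb]_(u in `[s, h + s]) f (T u x) -
    \int[leb]_(u in `[t, h + t]) f (T u x) =
    \int[leb]_(u in `[s, t]) f (T u x) - \int[leb]_(u in `[h + s, h + t]) f (T u x).
  by move: E; clear; lra.
have -> : (C + C) * `|s - t| = C * (t - s) + C * (t - s).
  by rewrite distrC ger0_norm ?subr_ge0// mulrDl.
apply: le_trans (ler_normB _ _) _.
apply: lerD; first exact: le_norm_itv bo.
apply: le_trans (le_norm_itv hst bo) _.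
by rewrite (_ : h + t - (h + s) = t - s)//; ring.
Qed.

(** The approximations are local averages of f in time, which are Lipschitz along
    orbits. *)
Lemma ae_lipschitz_approximable C f : bounded_by C f ->
  {ae mu, forall x, lipschitz_approximable (fun t => f (T t x))}.
Proof.
move=> bf; have bla n := bounded_by_local_average hT n bf.
have bdev n := bounded_by_norm (bounded_byB bf (bla n)).
have := small_mean hT bdev (fun n x => normr_ge0 _) (local_deviation hT bf).
apply: filterS => x small e e0; have [n [b [be Hb]]] := small e e0.
exists (fun t => local_average T f n (T t x)), C, (n.+1%:R * (C + C)), b; split=> //.
  exact: (bounded_by_orbit hT x (bounded_by_local_average hT n bf)).
exact: local_average_lipschitz.
Qed.

(** At the point T u x, the window mean of length n + 1 minus orbit_mean T f x is
    the deviation of the ergodic average from its limit. *)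
Lemma ae_small_window_means C f : bounded_by C f ->
  {ae mu, forall x, small_window_means (fun u => f (T u x) - orbit_mean T f x)}.
Proof.
move=> bf; have bom := bounded_by_orbit_mean hT bf.
have bdev n := bounded_by_norm (bounded_byB (bounded_by_orbit_average hT n bf) bom).
have := small_mean hT bdev (fun n x => normr_ge0 _) (ergodic_deviation hT bf).
apply: filterS => x small e e0; have [n [b [be Hb]]] := small e e0.
exists n.+1%:R, b; split=> //.
suff -> : (fun u => `|n.+1%:R^-1 * \int[leb]_(w in `[0, n.+1%:R])
    (f (T (u + w) x) - orbit_mean T f x)|) =
  (fun u => `|orbit_average T f n (T u x) - orbit_mean T f (T u x)|) by [].
apply/funext => u; congr `|_|.
have bo := bounded_by_orbit hT (T u x) bf.
rewrite (orbit_mean_flow hT _ _ bf) /orbit_average.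
transitivity (n.+1%:R^-1 * \int[leb]_(w in `[0, n.+1%:R])
    (f (T w (T u x)) - orbit_mean T f x)).
  by congr (_ * _); apply: eq_Rintegral => w _; rewrite (addrC u w) (flowD hT).
rewrite (RintegralB_itv _ _ bo (bounded_by_cst R (orbit_mean T f x))).
rewrite Rintegral_cst_itv// subr0 mulrBr mulrCA mulVf ?mulr1// pnatr_eq0.
Qed.

End generic_orbits.

Theorem theoremC (R : realType) (d : measure_display) (X : measurableType d)
    (mu : probability X R) (T S : R -> X -> X) (c : R)
    (hX : lebesgue_space mu)
    (hT : measurable_flow mu T) (hS : measurable_flow mu S)
    (k : nat) (hk : (0 < k)%N)
    (P : mpoly k int) (hP : mpoly_degree P = 1%N)
    (f g : X -> R) (hf : f \in Lfun mu +oo%E) (hg : g \in Lfun mu +oo%E) :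
  {ae mu, forall x, cvg (box_average T S c P f g x @ min_pinfty R k)} /\
  {ae mu, forall x,
    lim (box_average T S c P f g x @ min_pinfty R k) =
    cond_exp mu (invariant_sigma_algebra mu T) f x *
    cond_exp mu (invariant_sigma_algebra mu S) g x}.
Proof.
have [mf [C [f' [bf ff']]]] := Lfun_bounded_version hf.
have [mg [C' [g' [bg gg']]]] := Lfun_bounded_version hg.
pose Q (t : k.-tuple R) := c * mpoly_eval P t.
have aQ : affine Q by apply: affineZ; apply: affine_mpoly_eval; rewrite hP.
have mphase : measurable_fun setT (fun t : k.-tuple R => norm1 t ^+ 2 + Q t).
  apply: measurable_funD; last exact: measurable_affine.
  by apply: measurable_funX; exact: measurable_norm1.
suff main : {ae mu, forall x, box_average T S c P f g x @ min_pinfty R k -->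
    orbit_mean T f' x * orbit_mean S g' x}.
  split; first by apply: filterS main => x; exact: cvgP.
  apply: filterS3 main (cond_exp_orbit_mean hT mf ff' bf)
    (cond_exp_orbit_mean hS mg gg' bg) => x fg_cvg -> ->.
  by apply: cvg_lim => //; exact: Rhausdorff.
have fT := ae_orbit hT (lebesgue_tuple R k) (@measurable_norm1 R k) ff'.
have gS := ae_orbit hS (lebesgue_tuple R k) mphase gg'.
apply: filterS3 (filterI fT gS) (birkhoff hT bf)
  (filterI (ae_lipschitz_approximable hT bf) (ae_small_window_means hS bg)).
move=> x [fTx gSx] fmean [flip gwin].
have := box_mean_product hk aQ (bounded_by_orbit hT x bf) flip fmean
  (bounded_by_orbit hS x bg) gwin.
apply: cvg_trans; apply: near_eq_cvg; apply: nearW => M.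
rewrite /box_mean /box_average; congr (_ * _); congr fine.
have mflow U (hU : measurable_flow mu U) (v : k.-tuple R -> R) (h : X -> R) :
    measurable_fun setT v -> measurable_fun setT h ->
    measurable_fun setT (fun t => h (U (v t) x)).
  move=> mv mh; have [_ _ _ mU] := hU; apply: measurableT_comp mh _.
  apply: (measurableT_comp (f := fun p : R * X => U p.1 p.2)
    (g := fun t => (v t, x))) => //.
  by apply/measurable_fun_pair.
have mn := @measurable_norm1 R k.
apply: ae_eq_integral.
- exact: measurable_box.
- apply/measurable_EFinP/measurable_funTS/measurable_funM.
    by apply: (mflow _ hT _ _ mn); case: bf.
  by apply: (mflow _ hS _ _ mphase); case: bg.
- apply/measurable_EFinP/measurable_funTS/measurable_funM.
    exact: (mflow _ hT _ _ mn).
  exact: (mflow _ hS _ _ mphase).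
- by apply: filterS2 fTx gSx => t ft gt _; rewrite ft gt.
Qed.
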